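(* Consider the PPO-Clip algorithm with forward KL regularization started from $\pi_{\theta_{1,1}}=\pi_{\mathrm{ref}}$, and suppose the nonnegative stepsizes satisfy, for every $n$, $\sum_{i=1}^K\eta_{n,i}=S_{\max}$, where $$0<S_{\max}\le\min\Big\{\frac{1-\gamma}{8C_e},\ \frac{(1-\gamma)\log2}{4\tilde A^F_{\max}+8\lambda},\ \frac{1}{8L}\Big\}.$$ Then for every initial state distribution $\rho$ and every $n\ge1$, $$\tilde V_\lambda^{\pi^*}(\rho)-\tilde V_\lambda^{\pi_{n,1}}(\rho)\le\frac{\tilde V_\lambda^{\pi^*}(u)-\tilde V_\lambda^{\pi_{1,1}}(u)}{c_u(1-\gamma)}\,e^{-C(n-1)},$$ with $C:=(1-\gamma)\lambda S_{\max}c_uc_{\pi_{\mathrm{ref}}}(c^F)^2\,\|d_u^{\pi^*}/u\|_\infty^{-1}$.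
   Context: Setting. $(\mathcal S,\mathcal A,\mathcal P,r,\gamma)$ is a discounted Markov decision process with finite state and action sets, transition probabilities $\mathcal P(s'|s,a)$, reward $r:\mathcal S\times\mathcal A\to[0,r_{\max}]$, discount $\gamma\in[0,1)$. For $\theta\in\mathbb{R}^{|\mathcal S||\mathcal A|}$, $\pi_\theta(a|s)=\exp(\theta_{sa})/\sum_{a'}\exp(\theta_{sa'})$ (softmax); $\pi(s)$ denotes $\pi(\cdot|s)$. $\pi_{\mathrm{ref}}$ is a fixed reference policy with $c_{\pi_{\mathrm{ref}}}:=\min_{s,a}\pi_{\mathrm{ref}}(a|s)>0$; $\lambda>0$; $u$ is a state distribution with $u(s)\ge c_u>0$ for all $s$. The forward KL regularizer is $D(\pi(s)):=\sum_a\pi_{\mathrm{ref}}(a|s)\log\frac{\pi_{\mathrm{ref}}(a|s)}{\pi(a|s)}$. Values. $\tilde V_\lambda^\pi(\rho)=\mathbb{E}[\sum_{t\ge0}\gamma^t(r(s_t,a_t)-\lambda D(\pi(s_t)))]$ with $s_0\sim\rho$, $a_t\sim\pi(\cdot|s_t)$, $s_{t+1}\sim\mathcal P(\cdot|s_t,a_t)$; $\tilde V_\lambda^\pi(s)$ is the value from $s_0=s$. $\tilde Q_\lambda^\pi(s,a)=r(s,a)-\lambda D(\pi(s))+\gamma\sum_{s'}\mathcal P(s'|s,a)\tilde V_\lambda^\pi(s')$ and $\tilde A_\lambda^\pi(s,a)=\tilde Q_\lambda^\pi(s,a)-\tilde V_\lambda^\pi(s)$. $\pi^*$ is a policy maximizing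 $\tilde V_\lambda^\pi(s)$ from every state $s$. $d_\rho^\pi(s)=(1-\gamma)\sum_{t\ge0}\gamma^t\Pr(s_t=s|s_0\sim\rho,\pi)$; $\|d/u\|_\infty=\max_sd(s)/u(s)$. Algorithm. For $n=1,2,\dots$ (outer loop) and $k=1,\dots,K$ (inner loop): $\theta_{n,k+1}=\theta_{n,k}+\eta_{n,k}g_{n,k}$ with $g_{n,k}=\nabla\mathcal L_n(\theta_{n,k})$; then $\theta_{n+1,1}=\theta_{n,K+1}$. Write $\pi_{n,k}=\pi_{\theta_{n,k}}$. With $\mathbb{E}_{\pi_{n,1}}:=\frac1{1-\gamma}\mathbb{E}_{s\sim d_u^{\pi_{n,1}},a\sim\pi_{n,1}(s)}$, $r_\theta^n=\pi_\theta(a|s)/\pi_{n,1}(a|s)$, $r_{\mathrm{ref}}^n=\pi_{\mathrm{ref}}(a|s)/\pi_{n,1}(a|s)$, and $\mathrm{clip}(v;1-\varepsilon_l,1+\varepsilon_h)$ the projection of $v$ onto $[1-\varepsilon_l,1+\varepsilon_h]$, where $0<\varepsilon_l<1$, $\varepsilon_h>0$, $$\mathcal L_n(\theta)=\mathbb{E}_{\pi_{n,1}}\big[\min\{r_\theta^n\tilde A_\lambda^{\pi_{n,1}},\ \mathrm{clip}(r_\theta^n;1-\varepsilon_l,1+\varepsilon_h)\tilde A_\lambda^{\pi_{n,1}}\}+\lambda r_{\mathrm{ref}}^n\log\pi_\theta(a|s)\big]$$ (all quantities evaluated at $(s,a)$). Gradient convention at kinks: $g_{n,k}=\mathbb{E}_{\pi_{n,1}}[\nabla_\theta\log\pi_{n,k}(a|s)\,(\mathbf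 1_{\mathcal N_{n,k}}(s,a)\,r^n_{\theta_{n,k}}\tilde A_\lambda^{\pi_{n,1}}+\lambda r_{\mathrm{ref}}^n)]$, where $(s,a)\in\mathcal N_{n,k}$ iff ($\tilde A_\lambda^{\pi_{n,1}}(s,a)\ge0$ and $r^n_{\theta_{n,k}}\le1+\varepsilon_h$) or ($\tilde A_\lambda^{\pi_{n,1}}(s,a)<0$ and $r^n_{\theta_{n,k}}\ge1-\varepsilon_l$). Constants. $\tilde V_0:=\tilde V_\lambda^{\pi_{1,1}}(u)$; $C_A:=\frac1{\lambda c_u}\big(\frac{r_{\max}}{1-\gamma}-\tilde V_0\big)$; $c^F:=\exp\big(-(C_A+\log|\mathcal A|)/c_{\pi_{\mathrm{ref}}}\big)$; $\tilde A^F_{\max}:=\sup\{|\tilde A_\lambda^{\pi_\theta}(s,a)|:\ s,a,\ \theta\text{ with }\tilde V_\lambda^{\pi_\theta}(u)\ge\tilde V_0\}$; $\kappa_\varepsilon:=\frac1{\log(1+\varepsilon_h)}-\frac1{\log(1-\varepsilon_l)}$; $C_e:=\tilde A^F_{\max}(\sqrt2\kappa_\varepsilon+3)+\lambda$; $L:=\frac{8}{(1-\gamma)^3}\big(r_{\max}+\lambda\log2+\lambda\frac{\log|\mathcal A|+C_A}{c_{\pi_{\mathrm{ref}}}}\big)$. *)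

(* Defs.v *)
From HB Require Import structures.
From mathcomp Require Import all_boot all_order all_algebra.
From mathcomp Require Import all_classical all_reals all_analysis.
From mathcomp Require Import ring lra.

Set Implicit Arguments.
Unset Strict Implicit.
Unset Printing Implicit Defensive.

Import Order.TTheory GRing.Theory Num.Theory.
Import numFieldNormedType.Exports.

Local Open Scope classical_set_scope.
Local Open Scope ring_scope.

Definition is_dist (R : realType) (T : finType) (p : T -> R) : Prop :=
  (forall x, 0 <= p x) /\ \sum_x p x = 1.

Definition point_mass (R : realType) (T : finType) (x : T) : T -> R :=
  fun y => (y == x)%:R.

Record mdp (R : realType) (S A : finType) := MDP {
  trans : S -> A -> S -> R;
  reward : S -> A -> R;
  reward_max : R;
  discount : R;
  trans_dist : forall s a, is_dist (trans s a);
  reward_bounds : forall s a, 0 <= reward s a <= reward_max;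
  discount_bounds : 0 <= discount < 1
}.

(* A stationary policy is a function pi with pi s a = pi(a|s). *)
Definition is_policy (R : realType) (S A : finType) (pi : S -> A -> R) : Prop :=
  forall s, is_dist (pi s).

Definition softmax (R : realType) (S A : finType) (theta : S -> A -> R) :
    S -> A -> R :=
  fun s a => expR (theta s a) / \sum_b expR (theta s b).

(* KL(p || q), with 0 log (0 / q) = 0 and p log (p / 0) = +oo for p > 0.  It is
   extended-real-valued because x / 0 = 0 and ln 0 = 0 in the library, so that
   a real-valued formula would wrongly reward policies with zero entries. *)
Definition kl (R : realType) (A : finType) (p q : A -> R) : \bar R :=
  (\sum_a (if p a == 0%R then 0
           else if q a == 0%R then +oo
           else (p a * ln (p a / q a))%:E))%E.

Section RegularizedMDP.
Variables (R : realType) (S A : finType) (M : mdp R S A).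
Variables (pi_ref : S -> A -> R) (lambda : R).
Implicit Types (pi : S -> A -> R) (rho u : S -> R).

Local Notation gamma := (discount M).

(* The probability of (s_0, a_0), ..., (s_{T-1}, a_{T-1}) when s_0 ~ mu,
   a_t ~ pi(s_t) and s_{t+1} ~ P(s_t, a_t). *)
Fixpoint traj_prob pi (mu : S -> R) (tr : seq (S * A)) : R :=
  match tr with
  | [::] => 1
  | (s, a) :: tr' => mu s * pi s a * traj_prob pi (trans M s a) tr'
  end.

Definition reg_reward pi (s : S) (a : A) : \bar R :=
  ((reward M s a)%:E - lambda%:E * kl (pi_ref s) (pi s))%E.

(* The expected discounted regularized return, as the limit in T of the
   expectation, over trajectories of length T, of the return truncated at T.
   It is -oo when pi visits a state where kl (pi_ref s) (pi s) is +oo (note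
   0 * -oo = 0: only trajectories of positive probability count). *)
Definition evalue pi rho : \bar R :=
  limn (fun T => \sum_(tr : T.-tuple (S * A))
    ((traj_prob pi rho tr)%:E *
     \sum_(t < T) (gamma ^+ t)%:E * reg_reward pi (tnth tr t).1 (tnth tr t).2))%E.

Definition value pi rho : R := fine (evalue pi rho).

Definition qvalue pi (s : S) (a : A) : R :=
  reward M s a - lambda * fine (kl (pi_ref s) (pi s))
  + gamma * \sum_s' trans M s a s' * value pi (point_mass R s').

Definition advantage pi (s : S) (a : A) : R :=
  qvalue pi s a - value pi (point_mass R s).

(* The comparison is in the extended reals and ranges over all policies,
   including those of value -oo. *)
Definition is_optimal pi : Prop :=
  is_policy pi /\
  forall pi' s, is_policy pi' ->
    (evalue pi' (point_mass R s) <= evalue pi (point_mass R s))%E.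

Definition state_prob pi rho (t : nat) (s : S) : R :=
  \sum_(tr : (t.+1).-tuple (S * A) | (tnth tr ord_max).1 == s)
    traj_prob pi rho tr.

Definition visitation pi rho (s : S) : R :=
  (1 - gamma) * limn (fun T => \sum_(t < T) gamma ^+ t * state_prob pi rho t s).

(* The base 0 of the maximum is harmless: both functions are nonnegative. *)
Definition mismatch (d u : S -> R) : R := \big[Num.max/0]_s (d s / u s).

(* theta with its coordinate (s, a) replaced by x. *)
Definition upd (theta : S -> A -> R) (s : S) (a : A) (x : R) : S -> A -> R :=
  fun s' a' => if (s' == s) && (a' == a) then x else theta s' a'.

(* The partial derivative at theta with respect to the coordinate (s, a). *)
Definition partial (f : (S -> A -> R) -> R) (theta : S -> A -> R)
    (s : S) (a : A) : R :=
  derive1 (fun x : R => f (upd theta s a x)) (theta s a).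

Section Algorithm.
Variables (u : S -> R) (eps_l eps_h : R).

Definition old_expect pi (f : S -> A -> R) : R :=
  (1 - gamma)^-1 * \sum_s visitation pi u s * \sum_a pi s a * f s a.

Definition clip (v : R) : R := Num.max (1 - eps_l) (Num.min v (1 + eps_h)).

Definition ratio (theta0 theta : S -> A -> R) (s : S) (a : A) : R :=
  softmax theta s a / softmax theta0 s a.

(* The surrogate of the outer iteration whose first iterate is theta0. *)
Definition ppo_objective (theta0 theta : S -> A -> R) : R :=
  old_expect (softmax theta0) (fun s a =>
    Num.min (ratio theta0 theta s a * advantage (softmax theta0) s a)
            (clip (ratio theta0 theta s a) * advantage (softmax theta0) s a)
    + lambda * (pi_ref s a / softmax theta0 s a) * ln (softmax theta s a)).

Definition unclipped (theta0 theta : S -> A -> R) (s : S) (a : A) : bool :=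
  ((0 <= advantage (softmax theta0) s a) &&
     (ratio theta0 theta s a <= 1 + eps_h))
  || ((advantage (softmax theta0) s a < 0) &&
     (1 - eps_l <= ratio theta0 theta s a)).

(* The coordinate (s', a') of the gradient of ppo_objective theta0 at theta;
   at the kinks of min and clip the unclipped branch is the one differentiated,
   see ppo_gradE below. *)
Definition ppo_grad (theta0 theta : S -> A -> R) (s' : S) (a' : A) : R :=
  old_expect (softmax theta0) (fun s a =>
    partial (fun th => ln (softmax th s a)) theta s' a' *
    ((unclipped theta0 theta s a)%:R * ratio theta0 theta s a *
       advantage (softmax theta0) s a
     + lambda * (pi_ref s a / softmax theta0 s a))).

(* theta n k is the k-th inner iterate of the n-th outer iteration; both
   indices start at 1. *)
Definition is_ppo_run (K : nat) (eta : nat -> nat -> R)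
    (theta : nat -> nat -> S -> A -> R) : Prop :=
  (forall n k s a, (1 <= n)%N -> (1 <= k <= K)%N ->
     theta n k.+1 s a
     = theta n k s a + eta n k * ppo_grad (theta n 1%N) (theta n k) s a) /\
  (forall n s a, (1 <= n)%N -> theta n.+1 1%N s a = theta n K.+1 s a).

End Algorithm.

(* The base 1 of the minimum is harmless: probabilities are at most 1. *)
Definition c_ref : R := \big[Num.min/1]_(sa : S * A) pi_ref sa.1 sa.2.

Section Constants.
Variables (u : S -> R) (c_u : R) (pi1 : S -> A -> R).

Definition C_A : R :=
  (reward_max M / (1 - gamma) - value pi1 u) / (lambda * c_u).

Definition c_F : R := expR (- (C_A + ln #|A|%:R) / c_ref).

Definition A_F_max : R :=
  sup [set x : R | exists (theta : S -> A -> R) (s : S) (a : A),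
         value pi1 u <= value (softmax theta) u /\
         x = `|advantage (softmax theta) s a|].

Definition kappa (eps_l eps_h : R) : R :=
  (ln (1 + eps_h))^-1 - (ln (1 - eps_l))^-1.

Definition C_e (eps_l eps_h : R) : R :=
  A_F_max * (Num.sqrt 2 * kappa eps_l eps_h + 3) + lambda.

Definition smoothness : R :=
  8 / (1 - gamma) ^+ 3 *
  (reward_max M + lambda * ln 2 + lambda * ((ln #|A|%:R + C_A) / c_ref)).

Definition step_bound (eps_l eps_h : R) : R :=
  Num.min ((1 - gamma) / (8 * C_e eps_l eps_h))
    (Num.min (((1 - gamma) * ln 2) / (4 * A_F_max + 8 * lambda))
             (1 / (8 * smoothness))).

Definition rate (pi_star : S -> A -> R) (S_max : R) : R :=
  (1 - gamma) * lambda * S_max * c_u * c_ref * c_F ^+ 2 *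
  (mismatch (visitation pi_star u) u)^-1.

End Constants.

End RegularizedMDP.

(* Off the kinks of min and clip, ppo_grad is the gradient of ppo_objective. *)
Section Gradient.
Variables (R : realType) (S A : finType).

Lemma is_derive_bigsum (T : finType) (f : T -> R -> R) (df : T -> R) (x : R) :
  (forall t, is_derive x 1 (f t) (df t)) ->
  is_derive x 1 (fun y => \sum_t f t y) (\sum_t df t).
Proof.
move=> h; elim: (index_enum T) => [|t r IH].
  under eq_fun do rewrite big_nil.
  by rewrite big_nil; exact: is_derive_cst.
under eq_fun do rewrite big_cons.
by rewrite big_cons; exact: is_deriveD.
Qed.

Lemma is_derive_lmul (c : R) (f : R -> R) (df x : R) :
  is_derive x 1 f df -> is_derive x 1 (fun y => c * f y) (c * df).
Proof. by move=> h; have := @is_deriveZ R R R f c x 1 df h. Qed.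

Lemma upd_id (theta : S -> A -> R) s a : upd theta s a (theta s a) = theta.
Proof.
apply/funext => s'; apply/funext => a'; rewrite /upd.
by case: andP => // -[/eqP -> /eqP ->].
Qed.

Lemma softmax_sum_gt0 (theta : S -> A -> R) s (a : A) :
  0 < \sum_b expR (theta s b).
Proof.
rewrite (bigD1 a)//= ltr_wpDr ?expR_gt0//.
by apply: sumr_ge0 => b _; exact: expR_ge0.
Qed.

Lemma softmax_gt0 (theta : S -> A -> R) s a : 0 < softmax theta s a.
Proof. by rewrite divr_gt0 ?expR_gt0// (softmax_sum_gt0 _ _ a). Qed.

Lemma derivable_softmax_upd (theta : S -> A -> R) s a s' a' :
  derivable (fun x => softmax (upd theta s a x) s' a') (theta s a) 1.
Proof.
have e b : is_derive (theta s a) 1 (fun x => expR (upd theta s a x s' b))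
    (((s' == s) && (b == a))%:R * expR (theta s' b)).
  rewrite /upd; case: (boolP ((s' == s) && (b == a))) => [/andP[/eqP -> /eqP ->]|_].
    by rewrite mul1r; exact: is_derive_expR.
  by rewrite mul0r; exact: is_derive_cst.
rewrite /softmax; apply: derivableM.
  exact: (@ex_derive _ _ _ _ _ _ _ (e a')).
apply: derivableV; last exact: (@ex_derive _ _ _ _ _ _ _ (is_derive_bigsum e)).
by rewrite upd_id gt_eqF// (softmax_sum_gt0 _ _ a).
Qed.

Lemma is_derive_ln_softmax (theta : S -> A -> R) s a s' a' :
  is_derive (theta s a) 1 (fun x => ln (softmax (upd theta s a x) s' a'))
    (partial (fun th => ln (softmax th s' a')) theta s a).
Proof.
rewrite /partial derive1E; apply/derivableP.
have d := @derivable_softmax_upd theta s a s' a'.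
apply: (@ex_derive _ _ _ _ _ _ _ (@is_derive1_comp R (@ln R)
  (fun x => softmax (upd theta s a x) s' a') _ _ _ (is_derive1_ln _) (derivableP d))).
exact: softmax_gt0.
Qed.

Lemma is_derive_softmax (theta : S -> A -> R) s a s' a' :
  is_derive (theta s a) 1 (fun x => softmax (upd theta s a x) s' a')
    (softmax theta s' a' *
     partial (fun th => ln (softmax th s' a')) theta s a).
Proof.
have d := derivableP (@derivable_softmax_upd theta s a s' a').
have l := is_derive_ln_softmax theta s a s' a'.
have p : 0 < softmax (upd theta s a (theta s a)) s' a' by exact: softmax_gt0.
have c := @is_derive1_comp R (@ln R)
  (fun x => softmax (upd theta s a x) s' a') _ _ _ (is_derive1_ln p) d.
apply: (is_derive_eq d).
rewrite -(@derive_val _ _ _ _ _ _ _ l) (@derive_val _ _ _ _ _ _ _ c).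
by rewrite upd_id mulVKf// gt_eqF// softmax_gt0.
Qed.

Lemma clipped_term (eps_l eps_h adv p0 dp x0 : R) (p : R -> R) :
  0 < eps_l -> 0 < eps_h -> p0 != 0 ->
  p x0 / p0 != 1 + eps_h -> p x0 / p0 != 1 - eps_l ->
  is_derive x0 1 p (p x0 * dp) ->
  is_derive x0 1 (fun x => Num.min (p x / p0 * adv)
                             (clip eps_l eps_h (p x / p0) * adv))
    (dp * ((((0 <= adv) && (p x0 / p0 <= 1 + eps_h)) ||
            ((adv < 0) && (1 - eps_l <= p x0 / p0)))%:R * (p x0 / p0) * adv)).
Proof.
move=> el eh p0n nh nl dpx.
set f := (fun x : R => _).
have dr : is_derive x0 1 (fun x => p x / p0) (p x0 / p0 * dp).
  have -> : (fun x => p x / p0) = (fun x => p0^-1 * p x).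
    by apply/funext => y; rewrite mulrC.
  by rewrite -mulrA mulrCA; exact: is_derive_lmul.
have cr : {for x0, continuous (fun x => p x / p0)}.
  by apply/differentiable_continuous/derivable1_diffP; case: dr.
have unclip : (\forall x \near x0, f x = p x / p0 * adv) ->
    is_derive x0 1 f (dp * (1 * (p x0 / p0) * adv)).
  move=> h; have d := is_derive_lmul adv dr.
  rewrite (_ : dp * _ = adv * (p x0 / p0 * dp)); last by ring.
  apply: near_eq_is_derive d.
  by near do (rewrite mulrC; apply/esym).
have clipd c : (\forall x \near x0, f x = c) ->
    is_derive x0 1 f (dp * (0 * (p x0 / p0) * adv)).
  move=> h; rewrite !mul0r mulr0.
  apply: near_eq_is_derive (is_derive_cst c x0 1).
  by near do apply/esym.
have [adv0|adv0] := leP 0 adv => /=.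
  rewrite orbF; have [rh|rh] := leP (p x0 / p0) (1 + eps_h) => /=.
    have {}rh : p x0 / p0 < 1 + eps_h by rewrite lt_neqAle nh.
    apply: unclip; near=> x.
    have xh : p x / p0 < 1 + eps_h by near: x; exact: (cvgr_lt _ cr).
    rewrite /f /clip (min_l (ltW xh)); apply: min_l.
    by rewrite ler_wpM2r// le_max lexx orbT.
  apply: (clipd ((1 + eps_h) * adv)); near=> x.
  have xh : 1 + eps_h < p x / p0 by near: x; exact: (cvgr_gt _ cr).
  rewrite /f /clip (min_r (ltW xh)) max_r; last by lra.
  by apply: min_r; rewrite ler_wpM2r// ltW.
have [rl|rl] := leP (1 - eps_l) (p x0 / p0) => /=.
  have {}rl : 1 - eps_l < p x0 / p0 by rewrite lt_neqAle eq_sym nl.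
  apply: unclip; near=> x.
  have xl : 1 - eps_l < p x / p0 by near: x; exact: (cvgr_gt _ cr).
  rewrite /f /clip; apply: min_l; apply: ler_wnM2r; first exact: ltW.
  by rewrite ge_max (ltW xl) ge_min lexx.
apply: (clipd ((1 - eps_l) * adv)); near=> x.
have xl : p x / p0 < 1 - eps_l by near: x; exact: (cvgr_lt _ cr).
have xh : p x / p0 <= 1 + eps_h by apply: (le_trans (ltW xl)); lra.
rewrite /f /clip (min_l xh) (max_l (ltW xl)); apply: min_r.
by apply: ler_wnM2r; exact: ltW.
Unshelve. all: by end_near. Qed.

Lemma ppo_gradE (M : mdp R S A) (pi_ref : S -> A -> R) (lambda : R)
    (u : S -> R) (eps_l eps_h : R) (theta0 theta : S -> A -> R) (s : S) (a : A) :
  0 < eps_l -> 0 < eps_h ->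
  (forall s a, ratio theta0 theta s a != 1 + eps_h) ->
  (forall s a, ratio theta0 theta s a != 1 - eps_l) ->
  partial (ppo_objective M pi_ref lambda u eps_l eps_h theta0) theta s a
  = ppo_grad M pi_ref lambda u eps_l eps_h theta0 theta s a.
Proof.
move=> el eh nh nl; rewrite /partial derive1E.
apply: derive_val; rewrite /ppo_objective /ppo_grad /old_expect.
apply: is_derive_lmul; apply: is_derive_bigsum => s'.
apply: is_derive_lmul; apply: is_derive_bigsum => a'.
apply: is_derive_lmul; rewrite mulrDr; apply: is_deriveD; last first.
  rewrite [X in is_derive _ _ _ X]mulrC; apply: is_derive_lmul.
  exact: is_derive_ln_softmax.
have sm := is_derive_softmax theta s a s' a'.
have := @clipped_term eps_l eps_h (advantage M pi_ref lambda (softmax theta0) s' a')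
  (softmax theta0 s' a') (partial (fun th => ln (softmax th s' a')) theta s a)
  (theta s a) (fun x => softmax (upd theta s a x) s' a') el eh.
rewrite upd_id; apply => //; first by rewrite gt_eqF// softmax_gt0.
- exact: nh.
- exact: nl.
Qed.
End Gradient.

(* Main.v *)
Require Import Defs.
From HB Require Import structures.
From mathcomp Require Import all_boot all_order all_algebra.
From mathcomp Require Import all_classical all_reals all_analysis.
From mathcomp Require Import ring lra.

Set Implicit Arguments.
Unset Strict Implicit.
Unset Printing Implicit Defensive.

Import Order.TTheory GRing.Theory Num.Theory.
Import numFieldNormedType.Exports.

Local Open Scope ring_scope.

(** The proof separates the states. By the performance difference lemma, the
    improvement of the value from one policy to another is the accumulation,
    along the chain of the new policy, of the one-step gains
      [sum_a pi'(a|s) A(s, a) + lambda (D(pi(s)) - D(pi'(s)))],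
    and the gain at [s] only depends on the logits at [s]. If [h_s] denotes its
    gradient there at [pi' = pi], everything follows from two inequalities.

    Ascent: after one outer iteration the gain at [s] is at least
    [S_max d_u(s) / (2 (1 - gamma)) * |h_s|^2] ([policy_gain_outer_ge]). Along the
    inner loop the distribution at [s] is an exponential tilting of the old one,
    and the clipped gradient differs from [h_s] by at most [3/2 C_e] times the
    displacement of the logits: a clipped action has a log-ratio of size at
    least [1 / kappa_eps], so clipping costs at most [kappa_eps] times the
    displacement. As [S_max d_u(s) / (1 - gamma) <= 1 / (8 C_e)], the iterates
    cannot leave the region where all inner gradients are within [3/13 |h_s|] of
    [h_s], and the second-order error of the gain is equally small
    ([inner_loop_ascent]). All gains being nonnegative, the value is
    nondecreasing, which keeps the policy in the initial superlevel set of the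
    value; there the divergence to the reference is at most [C_A], whence the
    bounds [A_F_max] on the advantages and [c_F] on the probabilities from below.
    No smoothness of the value as a function of all the logits is needed.

    Gradient domination: since the logarithm is strongly concave on ]0, 1], the
    gain of any competitor at [s] is at most
    [|h_s|^2 / (2 lambda c_ref c_F^2)] ([state_gain_le]).

    Summing both with the weights [u], with [d_u >= (1 - gamma) u], gives
    [gap_(n+1) <= (1 - C) gap_n <= e^(-C) gap_n] for the gap from [u], and
    optimality from every state transfers the bound to any initial distribution.
    Values are handled through the resolvent [sum_t gamma^t P^t] of the chain of
    states. An optimal policy has full support, since a vanishing probability
    makes the value from that state [-oo] ([optimal_positive]). *)

(** * Elementary inequalities *)

Section RealBounds.
Variable R : realType.
Implicit Types x y : R.

Lemma expR_taylor2_le x : `|x| <= 1 / 8 -> expR x - 1 - x <= 8 / 7 * x ^+ 2.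
Proof.
rewrite ler_norml => /andP[xl xu].
have e0 := expR_gt0 x; have := expR_ge1Dx (- x); rewrite expRN => e1.
have e2 : expR x * (1 - x) <= 1.
  by rewrite -[leRHS](@mulfV _ (expR x)) ?gt_eqF// ler_wpM2l// ltW.
have x0 : 0 < 1 - x by lra.
rewrite -(ler_pM2l x0); have x2 := sqr_ge0 x.
have : 0 <= x ^+ 2 * (1 / 7 - 8 / 7 * x) by apply: mulr_ge0 => //; lra.
nra.
Qed.

Lemma expR_sub1_norm_le x : `|x| <= 1 / 8 -> `|expR x - 1| <= 8 / 7 * `|x|.
Proof.
move=> h; have := expR_taylor2_le h; have := expR_ge1Dx x.
move: h; have [x0|x0] := leP 0 x.
  by rewrite (ger0_norm x0) => h e1 e2; rewrite ler_norml; apply/andP; split; nra.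
rewrite ltr0_norm// => h e1 e2.
rewrite ler_norml; apply/andP; split; first nra.
by have := expR_le1 x; rewrite (ltW x0); lra.
Qed.

Lemma ln_le_subr_sqr x : 0 < x -> x <= 1 -> ln x <= x - 1 - (x - 1) ^+ 2 / 2.
Proof.
move=> x0 x1.
(* The derivative of F is - (expR z - 1) ^+ 2. *)
pose F (z : R) := 2 * expR z - expR z ^+ 2 / 2 - z.
have dF z : is_derive z (1 : R) F (- (expR z - 1) ^+ 2).
  rewrite /F; apply: is_derive_eq.
  rewrite /GRing.scale /=; set e := expR z; by field.
have dvF z : derivable F z 1 by case: (dF z).
have cF (a b : R) : {within `[a, b], continuous F}%classic.
  apply: derivable_within_continuous => z _; exact: dvF.
have z0 : ln x <= 0 by exact: ln_le0.
have : F 0 <= F (ln x).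
  apply: (@ler0_derive1_nincr _ F (ln x) 0) => //.
  move=> z _; rewrite derive1E (@derive_val _ _ _ _ _ _ _ (dF z)).
  by rewrite oppr_le0 sqr_ge0.
by rewrite /F expR0 lnK ?posrE// => h; nra.
Qed.

Lemma expR_ge1DxDsqr x : 0 <= x -> 1 + x + x ^+ 2 / 2 <= expR x.
Proof.
move=> x0; pose F (z : R) := 1 + z + z ^+ 2 / 2 - expR z.
have dF z : is_derive z (1 : R) F (1 + z - expR z).
  rewrite /F; apply: is_derive_eq.
  by rewrite /GRing.scale /=; field.
have dvF z : derivable F z 1 by case: (dF z).
have : F x <= F 0.
  apply: (@ler0_derive1_nincr _ F 0 x) => //.
  - move=> z _; rewrite derive1E (@derive_val _ _ _ _ _ _ _ (dF z)) subr_le0.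
    exact: expR_ge1Dx.
  - apply: derivable_within_continuous => z _.
    exact: dvF.
by rewrite /F expR0; lra.
Qed.

Lemma ln_le_subr_sqrV x : 1 <= x -> ln x <= x - 1 - (1 - x^-1) ^+ 2 / 2.
Proof.
move=> x1; have x0 : 0 < x by lra.
have := expR_ge1DxDsqr (ln_ge0 x1).
have h1 : 1 - x^-1 <= ln x.
  by have := expR_ge1Dx (- ln x); rewrite expRN lnK ?posrE//; lra.
have h2 : 0 <= 1 - x^-1 by rewrite subr_ge0 invf_le1.
rewrite lnK ?posrE//; nra.
Qed.

(** Strong concavity of the logarithm on ]0, 1], with modulus 1. *)
Lemma ln_div_le_sqr x y : 0 < x <= 1 -> 0 < y <= 1 ->
  ln (x / y) <= (x - y) / y - (x - y) ^+ 2 / 2.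
Proof.
move=> /andP[x0 x1] /andP[y0 y1].
have -> : (x - y) / y = x / y - 1 by field; rewrite gt_eqF.
have [xy|xy] := leP x y.
  apply: le_trans (ln_le_subr_sqr _ _) _; first exact: divr_gt0.
    by rewrite ler_pdivrMr// mul1r.
  have : (x - y) ^+ 2 <= (x / y - 1) ^+ 2.
    have {1}-> : x - y = (x / y - 1) * y by field; rewrite gt_eqF.
    rewrite exprMn ler_piMr ?sqr_ge0// exprn_ile1// ltW//.
  by lra.
apply: le_trans (ln_le_subr_sqrV _) _; first by rewrite ler_pdivlMr// mul1r ltW.
have : (x - y) ^+ 2 <= (1 - (x / y)^-1) ^+ 2.
  have {1}-> : x - y = (1 - (x / y)^-1) * x by field; rewrite !gt_eqF.
  by rewrite exprMn ler_piMr ?sqr_ge0// exprn_ile1// ltW//.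
by lra.
Qed.

End RealBounds.

(** * Euclidean norm of finite families *)

Section EuclideanNorm.
Variables (R : realType) (T : finType).
Implicit Types x y : T -> R.

Definition l2norm x : R := Num.sqrt (\sum_a x a ^+ 2).

Lemma sumr_sqr_ge0 x : 0 <= \sum_a x a ^+ 2.
Proof. by apply: sumr_ge0 => a _; exact: sqr_ge0. Qed.

Lemma l2norm_ge0 x : 0 <= l2norm x.
Proof. exact: sqrtr_ge0. Qed.

Lemma l2norm_sqr x : l2norm x ^+ 2 = \sum_a x a ^+ 2.
Proof. by rewrite sqr_sqrtr// sumr_sqr_ge0. Qed.

Lemma l2norm_le x (c : R) : 0 <= c -> \sum_a x a ^+ 2 <= c ^+ 2 -> l2norm x <= c.
Proof. by move=> c0 h; rewrite -(@ler_pXn2r _ 2) ?nnegrE ?l2norm_ge0// l2norm_sqr. Qed.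

Lemma norm_le_l2norm x a : `|x a| <= l2norm x.
Proof.
rewrite -(@ler_pXn2r _ 2) ?nnegrE ?l2norm_ge0// l2norm_sqr real_normK ?num_real//.
by rewrite (bigD1 a)//= lerDl sumr_ge0// => b _; exact: sqr_ge0.
Qed.

Lemma sumr_mul_le_l2norm x y : \sum_a x a * y a <= l2norm x * l2norm y.
Proof.
have Y0 := sumr_sqr_ge0 y; have X0 := sumr_sqr_ge0 x.
have [Yz|Yn] := eqVneq (\sum_a y a ^+ 2) 0.
  rewrite big1 ?mulr_ge0 ?l2norm_ge0// => a _.
  have /eqP : y a ^+ 2 = 0.
    by have := psumr_eq0P (fun b _ => sqr_ge0 (y b)) Yz; exact.
  by rewrite sqrf_eq0 => /eqP ->; rewrite mulr0.
have Yp : 0 < \sum_a y a ^+ 2 by rewrite lt0r Yn.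
apply: (le_trans (ler_norm _)).
rewrite -(@ler_pXn2r _ 2) ?nnegrE ?mulr_ge0 ?l2norm_ge0//.
rewrite exprMn !l2norm_sqr real_normK ?num_real//.
set P := \sum_a x a * y a; set X := \sum_a x a ^+ 2; set Y := \sum_a y a ^+ 2.
have : 0 <= \sum_a (Y * x a - P * y a) ^+ 2 by exact: sumr_sqr_ge0.
have -> : \sum_a (Y * x a - P * y a) ^+ 2 = Y * (X * Y - P ^+ 2).
  rewrite (eq_bigr (fun a => Y ^+ 2 * x a ^+ 2 - 2 * Y * P * (x a * y a)
      + P ^+ 2 * y a ^+ 2)); last by move=> a _; ring.
  by rewrite big_split sumrB /= -!mulr_sumr -/P -/X -/Y; ring.
by rewrite pmulr_rge0// subr_ge0.
Qed.

Lemma l2normD x y : l2norm (x \+ y) <= l2norm x + l2norm y.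
Proof.
apply: l2norm_le; first by rewrite addr_ge0 ?l2norm_ge0.
rewrite (eq_bigr (fun a => x a ^+ 2 + 2 * (x a * y a) + y a ^+ 2)); last first.
  by move=> a _ /=; ring.
rewrite big_split big_split -mulr_sumr /= -!l2norm_sqr.
by have := sumr_mul_le_l2norm x y; nra.
Qed.

Lemma l2normZ (c : R) x : l2norm (fun a => c * x a) = `|c| * l2norm x.
Proof.
rewrite /l2norm; under eq_bigr do rewrite exprMn.
by rewrite -mulr_sumr sqrtrM ?sqr_ge0// sqrtr_sqr.
Qed.

End EuclideanNorm.

(** * Exponential tilting of a probability distribution *)

Section Tilt.
Variables (R : realType) (T : finType).
Implicit Types (p f d : T -> R).

Lemma dist_le1 p : is_dist p -> forall a, p a <= 1.
Proof.
by move=> [p0 p1] a; rewrite -p1 (bigD1 a)//= lerDl sumr_ge0.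
Qed.

Lemma mean_le p f (c : R) : is_dist p -> (forall a, f a <= c) ->
  \sum_a p a * f a <= c.
Proof.
move=> [p0 p1] h; rewrite -[leRHS]mul1r -p1 mulr_suml.
by apply: ler_sum => a _; rewrite ler_wpM2l.
Qed.

Lemma mean_ge p f (c : R) : is_dist p -> (forall a, c <= f a) ->
  c <= \sum_a p a * f a.
Proof.
move=> [p0 p1] h; rewrite -[leLHS]mul1r -p1 mulr_suml.
by apply: ler_sum => a _; rewrite ler_wpM2l.
Qed.

Lemma mean_norm_le p f (c : R) : is_dist p -> (forall a, `|f a| <= c) ->
  `|\sum_a p a * f a| <= c.
Proof.
move=> hp h; rewrite ler_norml mean_le ?mean_ge// => a;
  by have := h a; rewrite ler_norml => /andP[].
Qed.

(** The variance, computed from the second moment about any point. *)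
Lemma variance_shift p f (c : R) : is_dist p ->
  \sum_a p a * (f a - \sum_b p b * f b) ^+ 2
  = \sum_a p a * (f a - c) ^+ 2 - (\sum_b p b * f b - c) ^+ 2.
Proof.
move=> [_ p1]; set m := \sum_b p b * f b.
rewrite (eq_bigr (fun a => p a * (f a - c) ^+ 2 - 2 * (m - c) * (p a * f a)
  + p a * (m ^+ 2 - c ^+ 2))); last by move=> a _; ring.
rewrite big_split sumrB /= -mulr_sumr -mulr_suml p1 -/m. ring.
Qed.

Lemma mean_sqr_le p f : is_dist p ->
  (\sum_a p a * f a) ^+ 2 <= \sum_a p a * f a ^+ 2.
Proof.
move=> hp; have := variance_shift f 0 hp; rewrite subr0.
under [in X in _ = X - _ -> _]eq_bigr do rewrite subr0.
move=> h; rewrite -subr_ge0 -h; case: hp => p0 _.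
by apply: sumr_ge0 => a _; rewrite mulr_ge0// sqr_ge0.
Qed.

(** The image of a vector under the covariance matrix of a distribution has
    Euclidean norm at most the supremum norm of the vector. *)
Lemma l2norm_center_le p f (c : R) : is_dist p -> 0 <= c ->
  (forall a, `|f a| <= c) ->
  l2norm (fun a => p a * (f a - \sum_b p b * f b)) <= c.
Proof.
move=> hp c0 h; apply: l2norm_le => //; have [p0 _] := hp.
apply: (@le_trans _ _ (\sum_a p a * (f a - \sum_b p b * f b) ^+ 2)).
  apply: ler_sum => a _; rewrite exprMn ler_wpM2r ?sqr_ge0//.
  by rewrite expr2 ler_piMl// dist_le1.
rewrite (variance_shift f 0 hp); apply: (@le_trans _ _ (\sum_a p a * (f a - 0) ^+ 2)).
  by rewrite gerBl sqr_ge0.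
apply: mean_le => // a; rewrite subr0 -real_normK ?num_real//.
by rewrite ler_pXn2r ?nnegrE.
Qed.

(** The normalizing factor of [tilt] below. *)
Definition tilt_mass p d : R := \sum_b p b * expR (d b).

(** The distribution proportional to [p a * expR (d a)]; adding [d] to the
    logits of a softmax distribution [p] produces it. *)
Definition tilt p d (a : T) : R := p a * expR (d a) / tilt_mass p d.

Section Facts.
Variables (p d : T -> R).
Hypothesis hp : is_dist p.
Hypothesis p_gt0 : forall a, 0 < p a.

Local Notation Z := (tilt_mass p d).

Lemma tilt_mass_gt0 : 0 < Z.
Proof.
have [p0 p1] := hp; rewrite lt0r sumr_ge0 => [|a _]; last by rewrite mulr_ge0 ?expR_ge0.
rewrite andbT; apply/eqP => h.
have : \sum_a p a = 0.
  apply: big1 => a _.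
  have /eqP : p a * expR (d a) = 0.
    by have := psumr_eq0P (fun b _ => mulr_ge0 (p0 b) (expR_ge0 (d b))) h; exact.
  by rewrite mulf_eq0 (gt_eqF (expR_gt0 _)) orbF => /eqP.
by rewrite p1 => /eqP; rewrite oner_eq0.
Qed.

Lemma tilt_gt0 a : 0 < tilt p d a.
Proof. by rewrite divr_gt0 ?tilt_mass_gt0// mulr_gt0 ?expR_gt0. Qed.

Lemma tilt_dist : is_dist (tilt p d).
Proof.
split=> [a|]; first exact/ltW/tilt_gt0.
by rewrite -mulr_suml mulfV// gt_eqF// tilt_mass_gt0.
Qed.

Lemma ln_tilt_div a : ln (tilt p d a / p a) = d a - ln Z.
Proof.
have -> : tilt p d a / p a = expR (d a) / Z.
  by rewrite /tilt; field; rewrite !gt_eqF// tilt_mass_gt0.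
by rewrite ln_div ?posrE ?expR_gt0 ?tilt_mass_gt0// expRK.
Qed.

Lemma ln_tilt_mass_le (c : R) : (forall a, d a <= c) -> ln Z <= c.
Proof.
move=> h; rewrite -[leRHS]expRK ler_ln ?posrE ?expR_gt0 ?tilt_mass_gt0//.
by apply: mean_le => // a; rewrite ler_expR.
Qed.

Lemma ln_tilt_mass_ge (c : R) : (forall a, c <= d a) -> c <= ln Z.
Proof.
move=> h; rewrite -[leLHS]expRK ler_ln ?posrE ?expR_gt0 ?tilt_mass_gt0//.
by apply: mean_ge => // a; rewrite ler_expR.
Qed.

Lemma norm_ln_tilt_div_le a : `|ln (tilt p d a / p a)| <= 2 * l2norm d.
Proof.
have h b : - l2norm d <= d b <= l2norm d by rewrite -ler_norml norm_le_l2norm.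
have := @ln_tilt_mass_le (l2norm d) (fun b => (andP (h b)).2).
have := @ln_tilt_mass_ge (- l2norm d) (fun b => (andP (h b)).1).
rewrite ln_tilt_div ler_norml; have := andP (h a) => -[].
by move=> *; apply/andP; split; lra.
Qed.

Section Small.
Hypothesis d_small : forall a, `|d a| <= 1 / 8.

Local Notation m2 := (\sum_a p a * d a ^+ 2).

Lemma second_moment_ge0 : 0 <= m2.
Proof.
by have [p0 _] := hp; apply: sumr_ge0 => a _; rewrite mulr_ge0 ?sqr_ge0.
Qed.

Lemma second_moment_le : m2 <= l2norm d ^+ 2.
Proof.
rewrite l2norm_sqr; apply: ler_sum => a _.
by rewrite ler_piMl ?sqr_ge0// dist_le1.
Qed.

Lemma tilt_mass_sub1E : Z - 1 = \sum_a p a * (expR (d a) - 1).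
Proof.
have [_ p1] := hp; under eq_bigr do rewrite mulrBr mulr1.
by rewrite sumrB p1.
Qed.

Lemma tilt_mass_ge : 7 / 8 <= Z.
Proof.
apply: mean_ge => // a; have := expR_ge1Dx (d a).
by have := d_small a; rewrite ler_norml => /andP[]; lra.
Qed.

Lemma tilt_mass_sub1_le : Z - 1 <= \sum_a p a * d a + 8 / 7 * m2.
Proof.
rewrite tilt_mass_sub1E mulr_sumr -big_split /=; apply: ler_sum => a _.
rewrite [8 / 7 * _]mulrCA -mulrDr ler_wpM2l//; first by case: hp.
by have := expR_taylor2_le (d_small a); lra.
Qed.

Lemma mean_sqr_expR_sub1_le :
  \sum_a p a * (expR (d a) - 1) ^+ 2 <= (8 / 7) ^+ 2 * m2.
Proof.
rewrite mulr_sumr; apply: ler_sum => a _.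
rewrite [leRHS]mulrCA ler_wpM2l//; first by case: hp.
rewrite -exprMn -real_normK ?num_real// -[leRHS]real_normK ?num_real//.
rewrite ler_pXn2r ?nnegrE// normrM (ger0_norm (_ : 0 <= 8 / 7)); last by lra.
exact: expR_sub1_norm_le.
Qed.

Lemma sqr_tilt_mass_sub1_le : (Z - 1) ^+ 2 <= (8 / 7) ^+ 2 * m2.
Proof.
rewrite tilt_mass_sub1E; apply: le_trans mean_sqr_expR_sub1_le.
exact: mean_sqr_le.
Qed.

Lemma chi2_tilt_le :
  \sum_a p a * (expR (d a) / Z - 1) ^+ 2 <= (4 / 3 * l2norm d) ^+ 2.
Proof.
have Z0 := tilt_mass_gt0; have Z7 := tilt_mass_ge.
have -> : \sum_a p a * (expR (d a) / Z - 1) ^+ 2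
    = (\sum_a p a * (expR (d a) - Z) ^+ 2) / Z ^+ 2.
  rewrite mulr_suml; apply: eq_bigr => a _.
  by field; rewrite gt_eqF.
rewrite (variance_shift (fun a => expR (d a)) 1 hp) ler_pdivrMr ?exprn_gt0//.
have h1 := mean_sqr_expR_sub1_le; have h2 := second_moment_le; have h3 := second_moment_ge0.
have h4 := sqr_ge0 (Z - 1); have h5 := sqr_ge0 (l2norm d).
have h6 : 49 / 64 <= Z ^+ 2 by nra.
have h7 : 49 / 64 * l2norm d ^+ 2 <= Z ^+ 2 * l2norm d ^+ 2 by rewrite ler_wpM2r.
rewrite -/Z; nra.
Qed.

Lemma tilt_subE a : tilt p d a - p a = p a * (expR (d a) / Z - 1).
Proof. by rewrite /tilt; field; rewrite gt_eqF// tilt_mass_gt0. Qed.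

Lemma l2norm_tilt_sub_le : l2norm (fun a => tilt p d a - p a) <= 4 / 3 * l2norm d.
Proof.
apply: l2norm_le; first by have := l2norm_ge0 d; lra.
apply: le_trans chi2_tilt_le; apply: ler_sum => a _.
rewrite tilt_subE exprMn ler_wpM2r ?sqr_ge0//.
by rewrite expr2 ler_piMl ?dist_le1//; case: hp.
Qed.

Lemma norm_mean_tilt_sub_le f (c : R) : 0 <= c -> (forall a, `|f a| <= c) ->
  `|\sum_a (tilt p d a - p a) * f a| <= c * (4 / 3 * l2norm d).
Proof.
move=> c0 hf; have D0 := l2norm_ge0 d.
rewrite -(@ler_pXn2r _ 2) ?nnegrE//; last by apply: mulr_ge0 => //; lra.
rewrite real_normK ?num_real// exprMn.
under eq_bigr do rewrite tilt_subE -mulrA.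
apply: (le_trans (mean_sqr_le _ hp)).
apply: le_trans (ler_wpM2l (sqr_ge0 c) chi2_tilt_le).
rewrite mulr_sumr; apply: ler_sum => a _.
rewrite exprMn [leRHS]mulrCA ler_wpM2l//; first by case: hp.
rewrite [leRHS]mulrC ler_wpM2l ?sqr_ge0//.
by rewrite -real_normK ?num_real// ler_pXn2r ?nnegrE.
Qed.

(** A linear function of the tilted distribution is, up to second order, its
    linearization at [d = 0]. *)
Lemma mean_tilt_ge f (c : R) : 0 <= c -> (forall a, `|f a| <= c) ->
  \sum_a p a * f a = 0 ->
  \sum_a p a * f a * d a - 3 * c * l2norm d ^+ 2 <= \sum_a tilt p d a * f a.
Proof.
move=> c0 hf f0; have [p0 p1] := hp.
have Z0 := tilt_mass_gt0; have Z7 := tilt_mass_ge.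
have h1 := mean_sqr_expR_sub1_le; have h2 := second_moment_le; have h3 := second_moment_ge0.
set E := \sum_a p a * f a * (expR (d a) - 1).
have tE : \sum_a tilt p d a * f a = E - (Z - 1) / Z * E.
  transitivity (E / Z); last by field; rewrite gt_eqF.
  rewrite mulr_suml; apply/eqP; rewrite -subr_eq0 -sumrB; apply/eqP.
  rewrite (eq_bigr (fun a => Z^-1 * (p a * f a))) => [|a _].
    by rewrite -mulr_sumr f0 mulr0.
  by rewrite /tilt; field; rewrite gt_eqF.
have EL : \sum_a p a * f a * d a - E <= c * (8 / 7) * m2.
  rewrite -sumrB mulr_sumr; apply: ler_sum => a _.
  rewrite [leRHS]mulrCA (_ : _ - _ = p a * (- f a * (expR (d a) - 1 - d a))).
    2: by ring.
  rewrite ler_wpM2l//.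
  have t0 : 0 <= expR (d a) - 1 - d a by have := expR_ge1Dx (d a); lra.
  apply: (@le_trans _ _ (c * (expR (d a) - 1 - d a))).
    by rewrite ler_wpM2r//; have := hf a; rewrite ler_norml => /andP[]; lra.
  by rewrite -mulrA ler_wpM2l// expR_taylor2_le.
have EA : E ^+ 2 <= c ^+ 2 * ((8 / 7) ^+ 2 * m2).
  apply: le_trans (ler_wpM2l (sqr_ge0 c) h1).
  rewrite /E; under eq_bigr do rewrite -mulrA.
  apply: (le_trans (mean_sqr_le _ hp)).
  rewrite mulr_sumr; apply: ler_sum => a _.
  rewrite exprMn [leRHS]mulrCA ler_wpM2l// ler_wpM2r ?sqr_ge0//.
  by rewrite -real_normK ?num_real// ler_pXn2r ?nnegrE.
have ZE : (Z - 1) * E <= c * ((8 / 7) ^+ 2 * m2).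
  (* Both factors are controlled by the root mean square of [expR \o d - 1]. *)
  apply: (le_trans (ler_norm _)).
  have s0 : 0 <= (8 / 7) ^+ 2 * m2 by rewrite mulr_ge0 ?exprn_ge0//; lra.
  rewrite -(@ler_pXn2r _ 2) ?nnegrE ?mulr_ge0//.
  rewrite real_normK ?num_real// exprMn.
  have -> : (c * ((8 / 7) ^+ 2 * m2)) ^+ 2
    = ((8 / 7) ^+ 2 * m2) * (c ^+ 2 * ((8 / 7) ^+ 2 * m2)) by ring.
  by apply: ler_pM; rewrite ?sqr_ge0// sqr_tilt_mass_sub1_le.
have ZE' : (Z - 1) / Z * E <= 8 / 7 * (c * ((8 / 7) ^+ 2 * m2)).
  have c1 : 0 <= c * ((8 / 7) ^+ 2 * m2).
    by rewrite mulr_ge0// mulr_ge0// exprn_ge0//; lra.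
  rewrite mulrAC ler_pdivrMr//; nra.
have cm := ler_wpM2l c0 h2; have cm0 := mulr_ge0 c0 h3.
rewrite tE; nra.
Qed.

End Small.
End Facts.
End Tilt.

(** * The inner loop at one state *)

Section InnerLoop.
Variables (R : realType) (T : finType) (p q adv : T -> R) (lam am kap : R).
Hypotheses (hp : is_dist p) (p_gt0 : forall a, 0 < p a) (hq : is_dist q).
Hypotheses (lam_gt0 : 0 < lam) (kap_ge0 : 0 <= kap).
Hypotheses (am_ge0 : 0 <= am) (adv_le : forall a, `|adv a| <= am).
Hypothesis adv_mean : \sum_a p a * adv a = 0.

(** The gradient of the regularized surrogate with respect to the logits of a
    single state, at the distribution [p'], when [I] is the set of unclipped
    actions; [p] is the distribution from which the advantages were computed. *)
Definition clipped_grad (p' : T -> R) (I : T -> bool) (a : T) : R :=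
  p' a * ((I a)%:R * adv a - \sum_b p' b * ((I b)%:R * adv b))
  + lam * (q a - p' a).

(** [clipped_grad] at [p] itself, where no action is clipped. *)
Definition state_grad (a : T) : R := p a * adv a + lam * (q a - p a).

(** Up to the factor [3 / 2], a Lipschitz constant at [d = 0] of the map from the
    displacement [d] of the logits to [clipped_grad (tilt p d)]; it is [C_e] when
    [am] bounds the advantages and [kap] is [kappa]. *)
Definition lipschitz_const : R := am * (Num.sqrt 2 * kap + 3) + lam.

(** The increment, from [p] to [p'], of the unclipped surrogate. *)
Definition state_gain (p' : T -> R) : R :=
  \sum_a p' a * adv a + lam * \sum_a q a * ln (p' a / p a).

Local Notation G := clipped_grad.
Local Notation h := state_grad.
Local Notation Ce := lipschitz_const.
Local Notation H := (l2norm state_grad).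

Lemma sqrt2_ge : 4 / 3 <= Num.sqrt 2 :> R.
Proof.
rewrite -(@ler_pXn2r _ 2) ?nnegrE ?sqrtr_ge0//.
by rewrite sqr_sqrtr//; lra.
Qed.

Lemma lipschitz_const_gt0 : 0 < Ce.
Proof.
rewrite /lipschitz_const ltr_wpDl//.
by rewrite mulr_ge0 ?addr_ge0 ?mulr_ge0 ?sqrtr_ge0.
Qed.

Lemma lipschitz_const_ge : 3 * am + 4 / 3 * (am * kap) + lam <= Ce.
Proof.
have := @sqrt2_ge => h2; have ak := mulr_ge0 am_ge0 kap_ge0.
rewrite /lipschitz_const; nra.
Qed.

Lemma norm_clipped_grad_le p' (I : T -> bool) a : is_dist p' ->
  `|G p' I a| <= 2 * am + lam.
Proof.
move=> hp'; have Iadv b : `|(I b)%:R * adv b| <= am.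
  by case: (I b); rewrite ?mul1r// mul0r normr0.
apply: (le_trans (ler_normD _ _)); apply: lerD; last first.
  rewrite normrM gtr0_norm// ler_piMr ?(ltW lam_gt0)//.
  have [q0 _] := hq; have [p0 _] := hp'.
  have := dist_le1 hq a; have := dist_le1 hp' a; have := q0 a; have := p0 a.
  by rewrite ler_norml => *; apply/andP; split; lra.
rewrite normrM ger0_norm; last by case: hp'.
apply: (@le_trans _ _ (1 * (2 * am))); last by rewrite mul1r.
apply: ler_pM => //; [by case: hp' | exact: dist_le1 |].
apply: (le_trans (ler_normB _ _)); have -> : 2 * am = am + am by ring.
by apply: lerD => //; exact: mean_norm_le.
Qed.

(** The four terms of the difference are due to the change of the distribution
    in the advantage term, to its mean, to the regularizer and to clipping. *)
Lemma clipped_grad_sub_le d (I : T -> bool) :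
  (forall a, `|d a| <= 1 / 8) ->
  (forall a, ~~ I a -> 1 <= kap * `|ln (tilt p d a / p a)|) ->
  l2norm (fun a => G (tilt p d) I a - h a) <= 3 / 2 * Ce * l2norm d.
Proof.
move=> d_small clip; set p' := tilt p d.
have hp' : is_dist p' := tilt_dist d hp p_gt0.
have D0 := l2norm_ge0 d; set D := l2norm d in D0 *.
pose x1 a := adv a * (p' a - p a).
pose x2 a := (- \sum_b (p' b - p b) * adv b) * p' a.
pose x3 a := - lam * (p' a - p a).
pose c a := (~~ I a)%:R * adv a.
pose x4 a := -1 * (p' a * (c a - \sum_b p' b * c b)).
have -> : (fun a => G p' I a - h a) = (x1 \+ x2) \+ (x3 \+ x4).
  apply/funext => a; rewrite /clipped_grad /state_grad /x1 /x2 /x3 /x4 /=.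
  have -> : \sum_b (p' b - p b) * adv b = \sum_b p' b * adv b.
    by under eq_bigr do rewrite mulrBl; rewrite sumrB adv_mean subr0.
  have -> : \sum_b p' b * c b
      = \sum_b p' b * adv b - \sum_b p' b * ((I b)%:R * adv b).
    rewrite -sumrB; apply: eq_bigr => b _; rewrite /c.
    by case: (I b); rewrite /= ?mul1r ?mul0r; ring.
  by rewrite /c; case: (I a); rewrite /= ?mul1r ?mul0r; ring.
have sub_le := l2norm_tilt_sub_le hp d_small; rewrite -/p' -/D in sub_le.
have n1 : l2norm x1 <= am * (4 / 3 * D).
  apply: (@le_trans _ _ (am * l2norm (fun a => p' a - p a))); last by rewrite ler_wpM2l.
  apply: l2norm_le; first by rewrite mulr_ge0// l2norm_ge0.
  rewrite exprMn l2norm_sqr mulr_sumr; apply: ler_sum => a _.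
  rewrite exprMn ler_wpM2r ?sqr_ge0//.
  by rewrite -real_normK ?num_real// ler_pXn2r ?nnegrE.
have n2 : l2norm x2 <= am * (4 / 3 * D).
  rewrite l2normZ normrN.
  apply: (@le_trans _ _ (am * (4 / 3 * D) * 1)); last by rewrite mulr1.
  apply: ler_pM; rewrite ?normr_ge0 ?l2norm_ge0//.
    exact: norm_mean_tilt_sub_le.
  apply: l2norm_le => //; have [p0 p1] := hp'.
  rewrite expr1n -p1; apply: ler_sum => a _.
  by rewrite expr2 ler_piMl// dist_le1.
have n3 : l2norm x3 <= lam * (4 / 3 * D).
  by rewrite l2normZ normrN gtr0_norm// ler_wpM2l// ltW.
have n4 : l2norm x4 <= am * (kap * (2 * D)).
  rewrite l2normZ normrN normr1 mul1r; apply: l2norm_center_le => //.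
    by rewrite !mulr_ge0.
  move=> a; rewrite /c; have := clip a; case: (I a) => /= cl.
    by rewrite mul0r normr0 !mulr_ge0.
  rewrite mul1r -[leLHS]mulr1; apply: ler_pM => //.
  apply: (le_trans (cl isT)); rewrite ler_wpM2l//.
  exact: norm_ln_tilt_div_le.
apply: (le_trans (l2normD _ _)).
have := l2normD x1 x2; have := l2normD x3 x4; move=> s34 s12.
have := ler_wpM2r D0 lipschitz_const_ge; have := mulr_ge0 am_ge0 D0.
have := mulr_ge0 (ltW lam_gt0) D0; lra.
Qed.

Lemma state_gain_ge d : (forall a, `|d a| <= 1 / 8) ->
  \sum_a h a * d a - 8 / 7 * Ce * l2norm d ^+ 2 <= state_gain (tilt p d).
Proof.
move=> d_small; have [q0 q1] := hq.
have t1 := mean_tilt_ge hp d_small am_ge0 adv_le adv_mean.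
have Z0 := tilt_mass_gt0 d hp.
have lnZ : ln (tilt_mass p d) <= tilt_mass p d - 1.
  by have := @le_ln1Dx R (tilt_mass p d - 1); rewrite [1 + _]addrC subrK; apply; lra.
have Z1 := tilt_mass_sub1_le hp d_small.
have m2 := second_moment_le d hp.
rewrite /state_gain; under [X in lam * X]eq_bigr do
  rewrite ln_tilt_div// mulrBr.
rewrite sumrB -mulr_suml q1 mul1r.
have -> : \sum_a h a * d a = \sum_a p a * adv a * d a
    + lam * (\sum_a q a * d a - \sum_a p a * d a).
  rewrite -sumrB mulr_sumr -big_split /=; apply: eq_bigr => a _.
  by rewrite /state_grad; ring.
have D2 := sqr_ge0 (l2norm d).
have := ler_wpM2r D2 lipschitz_const_ge.
have := mulr_ge0 am_ge0 D2; have := mulr_ge0 (mulr_ge0 am_ge0 kap_ge0) D2.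
have : lam * ln (tilt_mass p d)
    <= lam * (\sum_a p a * d a + 8 / 7 * l2norm d ^+ 2).
  by rewrite ler_wpM2l ?(ltW lam_gt0)//; lra.
by rewrite mulrDr; lra.
Qed.

Section Iterations.
Variables (N : nat) (d : nat -> T -> R) (I : nat -> T -> bool) (w : nat -> R).
Hypothesis d0 : forall a, d 0%N a = 0.
Hypothesis dS : forall k a, (k < N)%N ->
  d k.+1 a = d k a + w k * G (tilt p (d k)) (I k) a.
Hypothesis w_ge0 : forall k, (k < N)%N -> 0 <= w k.
Hypothesis clip : forall k a, (k < N)%N ->
  ~~ I k a -> 1 <= kap * `|ln (tilt p (d k) a / p a)|.
Hypothesis w_sum : (\sum_(k < N) w k) * (8 * Ce) <= 1.

Local Notation s n := (\sum_(k < n) w k).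

Lemma partial_sum_ge0 n : (n <= N)%N -> 0 <= s n.
Proof.
by move=> nN; apply: sumr_ge0 => k _; apply: w_ge0; exact: leq_trans nN.
Qed.

Lemma partial_sum_le n : (n <= N)%N -> s n * Ce <= 1 / 8.
Proof.
move=> nN; have : s n <= s N.
  rewrite -!(big_mkord xpredT) (big_cat_nat (leq0n n) nN)/= lerDl.
  by rewrite big_nat; apply: sumr_ge0 => k /andP[_ kN]; exact: w_ge0.
move=> /(ler_wpM2r (ltW lipschitz_const_gt0)) /le_trans; apply.
by rewrite ler_pdivlMr// -mulrA [_ * 8]mulrC.
Qed.

(** The iterates stay so close to the start that every inner gradient is within
    [3 / 13] of the first one, relatively to the norm of the latter. The constant
    [16 / 13] solves [x = 1 + 3 / 16 * x], where [3 / 16] bounds the Lipschitz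
    constant [3 / 2 * Ce] times the total weight. *)
Lemma inner_iterates n : (n <= N)%N ->
  [/\ forall a, `|d n a| <= s n * (2 * am + lam),
      l2norm (d n) <= s n * (16 / 13 * H) &
      s n * (10 / 13 * H ^+ 2) <= \sum_a h a * d n a].
Proof.
have H0 := l2norm_ge0 state_grad.
elim: n => [_|n IH nN].
  rewrite big_ord0 !mul0r; split.
  - by move=> a; rewrite d0 normr0.
  - by apply: l2norm_le => //; rewrite big1 ?expr0n// => a _; rewrite d0 expr0n.
  - by rewrite big1// => a _; rewrite d0 mulr0.
have {IH}[i1 i2 i3] := IH (ltnW nN).
have w0 := w_ge0 nN; have sC := partial_sum_le (ltnW nN).
have s0 := partial_sum_ge0 (ltnW nN).
have small a : `|d n a| <= 1 / 8.
  apply: (le_trans (i1 a)); apply: le_trans sC; rewrite ler_wpM2l//.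
  have := lipschitz_const_ge; have := mulr_ge0 am_ge0 kap_ge0.
  by have := am_ge0; lra.
have dev := clipped_grad_sub_le small (fun a => clip nN (a := a)).
set g := G (tilt p (d n)) (I n) in dev.
have {}dev : l2norm (fun a => g a - h a) <= 3 / 13 * H.
  apply: (le_trans dev); apply: (@le_trans _ _ (3 / 2 * Ce * (s n * (16 / 13 * H)))).
    by apply: ler_wpM2l => //; have := lipschitz_const_gt0; lra.
  by have := ler_wpM2r H0 sC; lra.
have gE : g = h \+ (fun a => g a - h a) by apply/funext => a /=; ring.
have nS : d n.+1 = d n \+ (fun a => w n * g a).
  by apply/funext => a; rewrite dS.
rewrite big_ord_recr /= ![(_ + w n) * _]mulrDl; split.
- move=> a; rewrite nS /=; apply: (le_trans (ler_normD _ _)); apply: lerD => //.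
  rewrite normrM ger0_norm// ler_wpM2l// norm_clipped_grad_le//.
  exact: tilt_dist.
- rewrite nS; apply: (le_trans (l2normD _ _)); apply: lerD => //.
  rewrite l2normZ ger0_norm// ler_wpM2l// gE.
  by apply: (le_trans (l2normD _ _)); lra.
- rewrite nS (eq_bigr (fun a => h a * d n a + w n * (h a * g a))) => [|a _ /=].
    2: by ring.
  rewrite big_split /= lerD// -mulr_sumr ler_wpM2l//.
  have := sumr_mul_le_l2norm h (fun a => - 1 * (g a - h a)).
  rewrite l2normZ normrN normr1 mul1r => cs.
  have -> : \sum_a h a * g a = H ^+ 2 - \sum_a h a * (- 1 * (g a - h a)).
    by rewrite l2norm_sqr -sumrB; apply: eq_bigr => a _; ring.
  have := ler_wpM2l H0 dev; nra.
Qed.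

(** The inner loop gains at least half of what the first-order model predicts. *)
Lemma inner_loop_ascent :
  s N / 2 * \sum_a h a ^+ 2 <= state_gain (tilt p (d N)).
Proof.
have [i1 i2 i3] := inner_iterates (leqnn N).
have sC := partial_sum_le (leqnn N); have s0 := partial_sum_ge0 (leqnn N).
have small a : `|d N a| <= 1 / 8.
  apply: (le_trans (i1 a)); apply: le_trans sC; rewrite ler_wpM2l//.
  have := lipschitz_const_ge; have := mulr_ge0 am_ge0 kap_ge0.
  by have := am_ge0; lra.
(* The linear term leaves [10 / 13] and the quadratic one costs
   [8 / 7 * (1 / 8) * (16 / 13) ^+ 2], with a difference above [1 / 2]. *)
apply: le_trans (state_gain_ge small); rewrite -l2norm_sqr.
have H0 := l2norm_ge0 state_grad; have C0 := lipschitz_const_gt0.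
have D2 : l2norm (d N) ^+ 2 <= (s N * (16 / 13 * H)) ^+ 2.
  rewrite ler_pXn2r ?nnegrE ?l2norm_ge0//.
  by apply: mulr_ge0 => //; lra.
have {}D2 : Ce * l2norm (d N) ^+ 2 <= 1 / 8 * (s N * (16 / 13) ^+ 2 * H ^+ 2).
  apply: (le_trans (ler_wpM2l (ltW C0) D2)).
  rewrite [leLHS](_ : _ = s N * Ce * (s N * (16 / 13) ^+ 2 * H ^+ 2)); last by ring.
  apply: ler_wpM2r => //; apply: mulr_ge0; last exact: sqr_ge0.
  by apply: mulr_ge0 => //; rewrite sqr_ge0.
have := mulr_ge0 s0 (sqr_ge0 H); lra.
Qed.

End Iterations.

(** Gradient domination: strong concavity of the logarithm bounds the gain of
    any competitor by the squared gradient. *)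
Lemma state_gain_le p' (cq cp : R) : is_dist p' -> (forall a, 0 < p' a) ->
  0 < cq -> (forall a, cq <= q a) -> 0 < cp -> (forall a, cp <= p a) ->
  state_gain p' <= (\sum_a h a ^+ 2) / (2 * lam * cq * cp ^+ 2).
Proof.
move=> hp' p'0 cq0 qc cp0 pc.
have [_ p1] := hp; have [_ p'1] := hp'.
have l0 := lam_gt0.
apply: (@le_trans _ _ (\sum_a ((p' a - p a) * (h a / p a)
    - lam * cq / 2 * (p' a - p a) ^+ 2))).
  apply: (@le_trans _ _ (\sum_a ((p' a - p a) * adv a
     + lam * (q a * ((p' a - p a) / p a - (p' a - p a) ^+ 2 / 2))))).
    rewrite big_split /= -mulr_sumr; apply: lerD.
      by under [leRHS]eq_bigr do rewrite mulrBl; rewrite sumrB adv_mean subr0.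
    rewrite (ler_wpM2l (ltW l0))//; apply: ler_sum => a _.
    apply: ler_wpM2l; first by case: hq.
    by apply: ln_div_le_sqr; rewrite ?p'0 ?p_gt0 /= dist_le1.
  rewrite -subr_ge0 -sumrB.
  apply: (@le_trans _ _ (\sum_a (lam * (p a - p' a)))).
    by rewrite -mulr_sumr sumrB p1 p'1 subrr mulr0.
  apply: ler_sum => a _.
  have pa := p_gt0 a.
  have -> : (p' a - p a) * (h a / p a) - lam * cq / 2 * (p' a - p a) ^+ 2
   - ((p' a - p a) * adv a + lam * (q a * ((p' a - p a) / p a - (p' a - p a) ^+ 2 / 2)))
   = lam * (p a - p' a) + lam / 2 * ((q a - cq) * (p' a - p a) ^+ 2).
    by rewrite /state_grad; field; rewrite gt_eqF.
  rewrite lerDl; apply: mulr_ge0; first by rewrite divr_ge0// (ltW l0).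
  by rewrite mulr_ge0 ?sqr_ge0// subr_ge0.
rewrite mulr_suml; apply: ler_sum => a _; have pa := p_gt0 a.
set x := p' a - p a; set y := h a / p a.
apply: (@le_trans _ _ (y ^+ 2 / (2 * lam * cq))).
  rewrite ler_pdivlMr ?mulr_gt0//.
  have := sqr_ge0 (y - lam * cq * x); nra.
have -> : h a ^+ 2 / (2 * lam * cq * cp ^+ 2) = (h a / cp) ^+ 2 / (2 * lam * cq).
  by field; rewrite !gt_eqF.
rewrite ler_pM2r ?invr_gt0 ?mulr_gt0// /y !expr_div_n.
rewrite ler_wpM2l ?sqr_ge0// lef_pV2 ?posrE ?exprn_gt0//.
by rewrite ler_pXn2r ?nnegrE ?(ltW cp0) ?(ltW pa).
Qed.

End InnerLoop.

(** * Trajectories and the resolvent of a policy *)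

Lemma sum_tupleS (V : nmodType) (X : finType) (n : nat) (F : n.+1.-tuple X -> V) :
  \sum_tr F tr = \sum_x \sum_(tr : n.-tuple X) F (cons_tuple x tr).
Proof.
rewrite pair_big (reindex (fun y : X * n.-tuple X => cons_tuple y.1 y.2)) //=.
exists (fun tr => (thead tr, behead_tuple tr)).
  by move=> [x tr] _ /=; congr pair; apply/val_inj.
by move=> tr _ /=; rewrite [RHS]tuple_eta; apply/val_inj.
Qed.

Section Resolvent.
Variables (R : realType) (S A : finType) (M : mdp R S A) (pi : S -> A -> R).
Hypothesis pi_policy : is_policy pi.
Implicit Types (h : S -> R) (rho : S -> R).

Local Notation gamma := (discount M).

Lemma gamma_ge0 : 0 <= gamma.
Proof. by have /andP[] := discount_bounds M. Qed.

Lemma gamma_lt1 : gamma < 1.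
Proof. by have /andP[] := discount_bounds M. Qed.

Lemma subr1_gamma_gt0 : 0 < 1 - gamma.
Proof. by rewrite subr_gt0 gamma_lt1. Qed.

(** The transition operator of the Markov chain of states induced by [pi]. *)
Definition push h (s : S) : R :=
  \sum_a pi s a * \sum_s' trans M s a s' * h s'.

Lemma push_norm_le h (c : R) : (forall s, `|h s| <= c) -> forall s, `|push h s| <= c.
Proof.
move=> hc s; apply: mean_norm_le => // a; apply: mean_norm_le => //.
exact: trans_dist.
Qed.

Lemma push_ge0 h : (forall s, 0 <= h s) -> forall s, 0 <= push h s.
Proof.
move=> h0 s; apply: mean_ge => // a; apply: mean_ge => //; exact: trans_dist.
Qed.

Lemma push_cst (c : R) s : push (fun=> c) s = c.
Proof.
rewrite /push; under eq_bigr do rewrite -mulr_suml (trans_dist M _ _).2 mul1r.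
by rewrite -mulr_suml (pi_policy s).2 mul1r.
Qed.

Lemma push_sum (I : finType) (c : I -> R) (f : I -> S -> R) s :
  push (fun x => \sum_i c i * f i x) s = \sum_i c i * push (f i) s.
Proof.
rewrite /push; under [RHS]eq_bigr do rewrite mulr_sumr.
rewrite exchange_big; apply: eq_bigr => a _ /=.
under [RHS]eq_bigr do rewrite mulrCA mulr_sumr.
rewrite -mulr_sumr exchange_big; congr (_ * _); apply: eq_bigr => s' _ /=.
by rewrite mulr_sumr; apply: eq_bigr => i _; rewrite mulrCA.
Qed.

Lemma iter_push_norm_le h (c : R) n : (forall s, `|h s| <= c) ->
  forall s, `|iter n push h s| <= c.
Proof. by move=> hc; elim: n => //= n IH; exact: push_norm_le. Qed.

Lemma iter_push_ge0 h n : (forall s, 0 <= h s) -> forall s, 0 <= iter n push h s.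
Proof. by move=> hc; elim: n => //= n IH; exact: push_ge0. Qed.

Lemma iter_push_sum (I : finType) (c : I -> R) (f : I -> S -> R) n s :
  iter n push (fun x => \sum_i c i * f i x) s = \sum_i c i * iter n push (f i) s.
Proof.
elim: n s => //= n IH s; rewrite -push_sum; congr push.
by apply/funext => x.
Qed.

(** The truncation of [resolvent] at a finite horizon. *)
Definition truncated h (n : nat) (s : S) : R :=
  \sum_(t < n) gamma ^+ t * iter t push h s.

(** The discounted sum of the expectations of [h] along the chain of states
    started from a given state. *)
Definition resolvent h (s : S) : R := limn (fun n => truncated h n s).

Lemma is_cvg_truncated h s : cvgn (fun n => truncated h n s).
Proof.
pose c := \sum_x `|h x|.
have hc x : `|h x| <= c by rewrite /c (bigD1 x)//= lerDl sumr_ge0.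
have c0 : 0 <= c by exact: sumr_ge0.
have -> : (fun n => truncated h n s)
    = series (fun t => gamma ^+ t * iter t push h s).
  by apply/funext => n; rewrite /truncated /series /= big_mkord.
apply: normed_cvg; apply: (@series_le_cvg _ _ (geometric c gamma)).
- by move=> n /=.
- by move=> n; rewrite /geometric /= mulr_ge0// exprn_ge0// gamma_ge0.
- move=> n; rewrite /geometric /= normrM ger0_norm ?exprn_ge0 ?gamma_ge0//.
  by rewrite mulrC ler_wpM2r ?exprn_ge0 ?gamma_ge0// iter_push_norm_le.
- by apply: is_cvg_geometric_series; rewrite ger0_norm ?gamma_ge0 ?gamma_lt1.
Qed.

Lemma cvg_truncated h s : (truncated h n s @[n --> \oo] --> resolvent h s)%classic.
Proof. exact: is_cvg_truncated. Qed.

Lemma cvgn_sum (I : finType) (f : I -> nat -> R) (l : I -> R) :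
  (forall i, (f i n @[n --> \oo] --> l i)%classic) ->
  ((\sum_i f i n) @[n --> \oo] --> \sum_i l i)%classic.
Proof.
move=> fl; elim: (index_enum I) => [|i r IH].
  by under eq_fun do rewrite big_nil; rewrite big_nil; exact: cvg_cst.
by under eq_fun do rewrite big_cons; rewrite big_cons; exact: cvgD.
Qed.

Lemma cvgn_lin (I : finType) (c : I -> R) (f : I -> nat -> R) (l : I -> R) :
  (forall i, (f i n @[n --> \oo] --> l i)%classic) ->
  ((\sum_i c i * f i n) @[n --> \oo] --> \sum_i c i * l i)%classic.
Proof. by move=> fl; apply: cvgn_sum => i; apply: cvgM => //; exact: cvg_cst. Qed.

Lemma truncatedS h n s :
  truncated h n.+1 s = h s + gamma * truncated (push h) n s.
Proof.
rewrite /truncated big_ord_recl expr0 mul1r mulr_sumr; congr (_ + _).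
by apply: eq_bigr => t _; rewrite exprS -mulrA -iterSr.
Qed.

Lemma push_truncated h n s : push (truncated h n) s = truncated (push h) n s.
Proof.
rewrite /truncated push_sum; apply: eq_bigr => t _.
by rewrite -iterS iterSr.
Qed.

(** The resolvent equation. *)
Lemma resolvent_push h s : resolvent h s = h s + gamma * resolvent (push h) s.
Proof.
have := @cvg_truncated h s; rewrite -cvg_shiftS /=.
under eq_fun do rewrite truncatedS.
move=> /cvg_lim <- //; apply: cvg_lim => //.
apply: cvgD; first exact: cvg_cst.
by apply: cvgM; [exact: cvg_cst | exact: cvg_truncated].
Qed.

Lemma push_resolvent h s : push (resolvent h) s = resolvent (push h) s.
Proof.
apply/esym/cvg_lim => //.
under eq_fun do rewrite -push_truncated.
apply: cvgn_lin => a; apply: cvgn_lin => s'; exact: cvg_truncated.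
Qed.

Lemma resolvent_sum (I : finType) (c : I -> R) (f : I -> S -> R) s :
  resolvent (fun x => \sum_i c i * f i x) s = \sum_i c i * resolvent (f i) s.
Proof.
apply: cvg_lim => //.
have -> : (fun n => truncated (fun x => \sum_i c i * f i x) n s)
    = (fun n => \sum_i c i * truncated (f i) n s).
  apply/funext => n; rewrite /truncated.
  under [RHS]eq_bigr do rewrite mulr_sumr.
  rewrite exchange_big; apply: eq_bigr => t _ /=.
  by rewrite iter_push_sum mulr_sumr; apply: eq_bigr => i _; rewrite mulrCA.
by apply: cvgn_lin => i; exact: cvg_truncated.
Qed.

Lemma resolventB h h' s :
  resolvent (fun x => h x - h' x) s = resolvent h s - resolvent h' s.
Proof.
pose f (b : bool) := if b then h else h'.
have := resolvent_sum (fun b : bool => (-1) ^+ ~~ b) f s.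
rewrite !big_bool /= expr0 expr1 mul1r mulN1r => <-.
by congr (resolvent _ s); apply/funext => x; rewrite big_bool /= mul1r mulN1r.
Qed.

Lemma resolventZ (c : R) h s :
  resolvent (fun x => c * h x) s = c * resolvent h s.
Proof.
have := resolvent_sum (fun _ : unit => c) (fun _ => h) s.
rewrite big_const card_unit /= addr0 => <-.
by congr (resolvent _ s); apply/funext => x; rewrite big_const card_unit /= addr0.
Qed.

Lemma resolvent_indic h s :
  resolvent h s = \sum_x h x * resolvent (fun y => (y == x)%:R) s.
Proof.
rewrite -resolvent_sum; congr (resolvent _ s); apply/funext => y.
rewrite (bigD1 y)//= eqxx mulr1 big1 ?addr0// => x /negPf xy.
by rewrite eq_sym xy mulr0.
Qed.

Lemma resolvent_ge0 h : (forall s, 0 <= h s) -> forall s, 0 <= resolvent h s.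
Proof.
move=> h0 s; apply: limr_ge; first exact: is_cvg_truncated.
apply: nearW => n; apply: sumr_ge0 => t _.
by rewrite mulr_ge0 ?exprn_ge0 ?gamma_ge0// iter_push_ge0.
Qed.

Lemma resolvent_ge h : (forall s, 0 <= h s) -> forall s, h s <= resolvent h s.
Proof.
move=> h0 s; rewrite resolvent_push lerDl mulr_ge0 ?gamma_ge0//.
by apply: resolvent_ge0; exact: push_ge0.
Qed.

Lemma le_resolvent h h' : (forall s, h s <= h' s) ->
  forall s, resolvent h s <= resolvent h' s.
Proof.
move=> hh s; rewrite -subr_ge0 -resolventB; apply: resolvent_ge0 => x.
by rewrite subr_ge0.
Qed.

Lemma resolvent_cst (c : R) s : resolvent (fun=> c) s = c / (1 - gamma).
Proof.
have := resolvent_push (fun=> c) s.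
have -> : push (fun=> c) = (fun=> c) by apply/funext => x; exact: push_cst.
move: (resolvent _ s) => r rE; have g0 := subr1_gamma_gt0.
rewrite -[LHS](mulfK (lt0r_neq0 g0)); congr (_ / _).
by rewrite mulrBr mulr1 [X in X - _]rE; ring.
Qed.

(** The expectation of an action-dependent function under the policy. *)
Definition policy_mean (g : S -> A -> R) (s : S) : R := \sum_a pi s a * g s a.

Lemma sum_traj_probS n rho (F : n.+1.-tuple (S * A) -> R) :
  \sum_(tr : n.+1.-tuple (S * A)) traj_prob M pi rho tr * F tr
  = \sum_s rho s * \sum_a pi s a * \sum_(tr : n.-tuple (S * A))
       traj_prob M pi (trans M s a) tr * F (cons_tuple (s, a) tr).
Proof.
pose G x := \sum_(tr : n.-tuple (S * A))
  traj_prob M pi rho (cons_tuple x tr) * F (cons_tuple x tr).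
rewrite sum_tupleS; transitivity (\sum_s \sum_a G (s, a)).
  by rewrite (pair_bigA _ (fun s a => G (s, a))); apply: eq_bigr => -[].
apply: eq_bigr => s _; rewrite mulr_sumr; apply: eq_bigr => a _.
by rewrite mulrA mulr_sumr; apply: eq_bigr => tr _; rewrite mulrA.
Qed.

Lemma sum_traj_prob n rho : is_dist rho ->
  \sum_(tr : n.-tuple (S * A)) traj_prob M pi rho tr = 1.
Proof.
elim: n rho => [|n IH] rho [rho0 rho1].
  rewrite (eq_bigr (fun=> 1)) => [|tr _]; last by rewrite tuple0.
  by rewrite sumr_const card_tuple expn0.
under eq_bigr do rewrite -[traj_prob _ _ _ _]mulr1.
rewrite (sum_traj_probS rho (fun=> 1)) -[RHS]rho1; apply: eq_bigr => s _.
rewrite -[RHS]mulr1 -[in RHS](pi_policy s).2; congr (_ * _); apply: eq_bigr => a _.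
under eq_bigr do rewrite /= mulr1.
by rewrite IH ?mulr1//; exact: trans_dist.
Qed.

(** The law of the state-action pair at time [t]: iterating [push] gives the
    expectations under the state marginal. *)
Lemma sum_traj_prob_tnth n (t : 'I_n) rho (g : S -> A -> R) : is_dist rho ->
  \sum_(tr : n.-tuple (S * A))
     traj_prob M pi rho tr * g (tnth tr t).1 (tnth tr t).2
  = \sum_s rho s * iter t push (policy_mean g) s.
Proof.
elim: n t rho => [[]//|n IH] t rho hrho.
rewrite (sum_traj_probS rho (fun tr => g (tnth tr t).1 (tnth tr t).2)).
apply: eq_bigr => s _; congr (_ * _).
case: (unliftP ord0 t) => [t' ->|->].
  rewrite [iter _ _ _]iterS /push; apply: eq_bigr => a _; congr (_ * _).
  under eq_bigr do rewrite tnthS.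
  by rewrite IH//; exact: trans_dist.
transitivity (policy_mean g s) => //; apply: eq_bigr => a _; congr (_ * _).
under eq_bigr do rewrite tnth0.
by rewrite -mulr_suml sum_traj_prob ?mul1r//; exact: trans_dist.
Qed.

Lemma visitationE rho s : is_dist rho ->
  visitation M pi rho s
  = (1 - gamma) * \sum_x rho x * resolvent (fun y => (y == s)%:R) x.
Proof.
move=> hrho; congr (_ * _); apply: cvg_lim => //.
have -> : (fun n => \sum_(t < n) gamma ^+ t * state_prob M pi rho t s)
    = (fun n => \sum_x rho x * truncated (fun y => (y == s)%:R) n x).
  apply/funext => n; rewrite /truncated.
  under [RHS]eq_bigr do rewrite mulr_sumr.
  rewrite exchange_big; apply: eq_bigr => t _ /=.
  under [RHS]eq_bigr do rewrite mulrCA.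
  rewrite -mulr_sumr; congr (_ * _); rewrite /state_prob big_mkcond /=.
  have := sum_traj_prob_tnth (@ord_max t) (fun s' a => (s' == s)%:R) hrho.
  have -> : policy_mean (fun s' _ => (s' == s)%:R) = (fun y => (y == s)%:R).
    apply/funext => y; rewrite /policy_mean -mulr_suml.
    by rewrite (pi_policy y).2 mul1r.
  move=> <-; apply: eq_bigr => tr _.
  by case: eqP => _; rewrite ?mulr1 ?mulr0.
by apply: cvgn_lin => x; exact: cvg_truncated.
Qed.

Lemma visitation_ge u s : is_dist u -> (1 - gamma) * u s <= visitation M pi u s.
Proof.
move=> hu; rewrite visitationE// ler_pM2l ?subr1_gamma_gt0//.
have [u0 _] := hu; have r0 x : 0 <= resolvent (fun y => (y == s)%:R) x.
  exact: resolvent_ge0.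
rewrite (bigD1 s)//= ler_wpDr//.
  by apply: sumr_ge0 => x _; rewrite mulr_ge0.
rewrite ler_peMr//.
have /(_ s) := @resolvent_ge (fun y => (y == s)%:R) (fun y => ler0n _ _).
by rewrite eqxx.
Qed.

(** The visitation is the occupation measure of the resolvent. *)
Lemma sum_visitation_mul u h : is_dist u ->
  \sum_s visitation M pi u s * h s = (1 - gamma) * \sum_x u x * resolvent h x.
Proof.
move=> hu; under eq_bigr do rewrite visitationE// -mulrA mulr_suml.
rewrite -mulr_sumr exchange_big; congr (_ * _); apply: eq_bigr => x _ /=.
rewrite [in RHS]resolvent_indic mulr_sumr; apply: eq_bigr => s _.
by rewrite -mulrA [h s * _]mulrC.
Qed.

Lemma visitation_dist u : is_dist u -> is_dist (visitation M pi u).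
Proof.
move=> hu; have [u0 u1] := hu; split=> [s|].
  apply: le_trans (visitation_ge s hu).
  by rewrite mulr_ge0// ltW// subr1_gamma_gt0.
have := sum_visitation_mul (fun=> 1) hu.
under eq_bigr do rewrite mulr1.
under [in RHS]eq_bigr do rewrite resolvent_cst.
rewrite -mulr_suml u1 => ->; have g0 := subr1_gamma_gt0.
by field; rewrite gt_eqF.
Qed.

End Resolvent.

(** * Regularized values *)

Section KullbackLeibler.
Variables (R : realType) (A : finType).
Implicit Types p q : A -> R.

Lemma klE p q : (forall a, 0 < p a) -> (forall a, 0 < q a) ->
  kl p q = (\sum_a p a * ln (p a / q a))%:E.
Proof.
move=> p0 q0; rewrite /kl -sumEFin; apply: eq_bigr => a _.
by rewrite !gt_eqF.
Qed.

Lemma kl_eqy p q a : 0 < p a -> q a = 0 -> kl p q = +oo%E.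
Proof.
move=> pa qa; apply/eqP; rewrite /kl esum_eqy => [|b _]; last first.
  by case: ifP => //; case: ifP.
by apply/existsP; exists a; rewrite /= qa eqxx (gt_eqF pa).
Qed.

Lemma fine_klE p q : (forall a, 0 < p a) -> (forall a, 0 < q a) ->
  fine (kl p q) = \sum_a p a * ln (p a / q a).
Proof. by move=> p0 q0; rewrite klE. Qed.

Lemma fine_kl_ge0 p q : is_dist p -> is_dist q ->
  (forall a, 0 < p a) -> (forall a, 0 < q a) -> 0 <= fine (kl p q).
Proof.
move=> [_ p1] [_ q1] p0 q0; rewrite fine_klE//.
apply: (@le_trans _ _ (\sum_a (p a - q a))); first by rewrite sumrB p1 q1 subrr.
apply: ler_sum => a _; have pa := p0 a; have qa := q0 a.
have qp : 0 < q a / p a by rewrite divr_gt0.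
have := @le_ln1Dx R (q a / p a - 1); rewrite [1 + _]addrC subrK.
have -> : ln (p a / q a) = - ln (q a / p a).
  by rewrite -lnV ?posrE// invf_div.
move=> /(_ ltac:(lra)) /(ler_wpM2l (ltW pa)).
by rewrite mulrBr mulrCA mulfV ?gt_eqF//; lra.
Qed.

(** The entropy of [p] is at most the logarithm of the number of actions. *)
Lemma cross_entropy_le p q : is_dist p -> (forall a, 0 < p a) ->
  (forall a, 0 < q a) ->
  - \sum_a p a * ln (q a) <= fine (kl p q) + ln #|A|%:R.
Proof.
move=> hp p0 q0; have [_ p1] := hp; rewrite fine_klE//.
have A0 : 0 < #|A|%:R :> R.
  rewrite ltr0n lt0n; apply/eqP => /card0_eq A0.
  move: p1; rewrite big_pred0 => [/esym/eqP|a]; first by rewrite oner_eq0.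
  exact: A0.
pose v (_ : A) : R := #|A|%:R^-1.
have v_dist : is_dist v.
  split=> [a|]; first by rewrite invr_ge0 ltW.
  by rewrite sumr_const -[_ *+ _]mulr_natr mulVf ?gt_eqF.
have v0 a : 0 < v a by rewrite invr_gt0.
have := fine_kl_ge0 hp v_dist p0 v0; rewrite fine_klE//.
have -> : \sum_a p a * ln (p a / v a) = \sum_a p a * ln (p a) + ln #|A|%:R.
  rewrite -[X in _ = _ + X]mul1r -[X in _ + X * _]p1 mulr_suml -big_split.
  apply: eq_bigr => a _ /=; rewrite -mulrDr /v invrK lnM ?posrE//.
have -> : \sum_a p a * ln (p a / q a) = \sum_a p a * ln (p a) - \sum_a p a * ln (q a).
  rewrite -sumrB; apply: eq_bigr => a _.
  by rewrite -mulrBr ln_div ?posrE.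
lra.
Qed.

End KullbackLeibler.

Section Values.
Variables (R : realType) (S A : finType) (M : mdp R S A).
Variables (pi_ref : S -> A -> R) (lambda : R).
Hypothesis ref_policy : is_policy pi_ref.
Hypothesis ref_gt0 : forall s a, 0 < pi_ref s a.
Hypothesis lambda_gt0 : 0 < lambda.
Implicit Types (pi : S -> A -> R) (rho u : S -> R).

Local Notation gamma := (discount M).
Local Notation D pi s := (fine (kl (pi_ref s) (pi s))).

(** A policy with full support: these are the policies with a finite value from
    every state. *)
Definition positive_policy pi : Prop :=
  is_policy pi /\ forall s a, 0 < pi s a.

Lemma point_mass_dist (s : S) : is_dist (point_mass R s).
Proof.
split=> [y|]; first exact: ler0n.
by rewrite /point_mass (bigD1 s)//= eqxx big1 ?addr0// => y /negPf ->.
Qed.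

Lemma sum_point_mass (s : S) (f : S -> R) : \sum_x point_mass R s x * f x = f s.
Proof.
rewrite /point_mass (bigD1 s)//= eqxx mul1r big1 ?addr0// => y /negPf ->.
by rewrite mul0r.
Qed.

(** The expected regularized reward of one step. *)
Definition mean_reward pi (s : S) : R :=
  \sum_a pi s a * reward M s a - lambda * D pi s.

Lemma policy_meanE pi : is_policy pi ->
  policy_mean pi (fun s a => reward M s a - lambda * D pi s) = mean_reward pi.
Proof.
move=> hpi; apply/funext => s; rewrite /policy_mean /mean_reward.
under eq_bigr do rewrite mulrBr.
by rewrite sumrB -mulr_suml (hpi s).2 mul1r.
Qed.

Lemma evalueE pi rho : positive_policy pi -> is_dist rho ->
  evalue M pi_ref lambda pi rho
  = (\sum_s rho s * resolvent M pi (mean_reward pi) s)%:E.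
Proof.
move=> [hpi pi0] hrho; rewrite /evalue -(policy_meanE hpi).
pose g s a := reward M s a - lambda * D pi s; rewrite -/g.
have -> : (fun n => \sum_(tr : n.-tuple (S * A))
    ((traj_prob M pi rho tr)%:E * \sum_(t < n) (gamma ^+ t)%:E
       * reg_reward M pi_ref lambda pi (tnth tr t).1 (tnth tr t).2))%E
    = EFin \o (fun n => \sum_s rho s * truncated M pi (policy_mean pi g) n s).
  apply/funext => n /=.
  transitivity (\sum_(tr : n.-tuple (S * A)) (traj_prob M pi rho tr
      * \sum_(t < n) gamma ^+ t * g (tnth tr t).1 (tnth tr t).2)%:E)%E.
    apply: eq_bigr => tr _; rewrite EFinM -sumEFin; congr (_ * _)%E.
    apply: eq_bigr => t _; rewrite /reg_reward klE// EFinM; congr (_ * _)%E.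
    by rewrite /g fine_klE// EFinB EFinM.
  rewrite sumEFin; congr EFin; rewrite /truncated.
  under [LHS]eq_bigr do rewrite mulr_sumr.
  rewrite [LHS]exchange_big /=; under [RHS]eq_bigr do rewrite mulr_sumr.
  rewrite [RHS]exchange_big; apply: eq_bigr => t _ /=.
  under [LHS]eq_bigr do rewrite mulrCA.
  under [RHS]eq_bigr do rewrite mulrCA.
  by rewrite -!mulr_sumr sum_traj_prob_tnth.
apply/cvg_lim => //; apply: cvg_EFin; first exact: nearW.
by apply: cvgn_lin => s; exact: cvg_truncated.
Qed.

Lemma valueE pi rho : positive_policy pi -> is_dist rho ->
  value M pi_ref lambda pi rho = \sum_s rho s * resolvent M pi (mean_reward pi) s.
Proof. by move=> hpi hrho; rewrite /value evalueE. Qed.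

Lemma value_point_massE pi s : positive_policy pi ->
  value M pi_ref lambda pi (point_mass R s) = resolvent M pi (mean_reward pi) s.
Proof.
by move=> hpi; rewrite valueE ?sum_point_mass//; exact: point_mass_dist.
Qed.

(** A policy that never takes some action in the state [s] has an infinite
    divergence there, which is met at time 0 when starting from [s]. *)
Lemma evalue_eqNy pi s a : is_policy pi -> pi s a = 0 ->
  evalue M pi_ref lambda pi (point_mass R s) = -oo%E.
Proof.
move=> hpi pisa.
have rrNy b : reg_reward M pi_ref lambda pi s b = -oo%E.
  by rewrite /reg_reward (kl_eqy (ref_gt0 s a) pisa) gt0_muley ?lte_fin.
apply/cvg_lim => //; rewrite -cvg_shiftS /=.
rewrite (_ : (fun n => _) = (fun=> -oo%E)); first exact: cvg_cst.
apply/funext => n; apply/eqP; rewrite esum_eqNy; apply/existsP.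
have := sum_traj_prob M hpi n.+1 (point_mass_dist s).
have [/existsP[tr tr0] _|/existsPn h] := boolP [exists tr : n.+1.-tuple (S * A),
    traj_prob M pi (point_mass R s) tr != 0]; last first.
  rewrite big1 => [/esym/eqP|tr _]; first by rewrite oner_eq0.
  by apply/eqP; have := h tr; rewrite negbK.
exists tr => /=.
have tr_ge0 : 0 <= traj_prob M pi (point_mass R s) tr.
  have ge0 l rho : is_dist rho -> 0 <= traj_prob M pi rho l.
    elim: l rho => //= -[x b] l IH rho [rho0 _].
    by rewrite !mulr_ge0//; [exact: (hpi x).1 | apply: IH; exact: trans_dist].
  by apply: ge0; exact: point_mass_dist.
have tr_gt0 : 0 < traj_prob M pi (point_mass R s) tr by rewrite lt0r tr0.
have tr_head : (tnth tr ord0).1 = s.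
  move: tr0; rewrite (tuple_eta tr) tnth0 /=; case: (thead tr) => x b /=.
  by rewrite /point_mass; case: (x =P s) => // _; rewrite !mul0r eqxx.
suff -> : (\sum_(t < n.+1) (gamma ^+ t)%:E
    * reg_reward M pi_ref lambda pi (tnth tr t).1 (tnth tr t).2)%E = -oo%E.
  by rewrite gt0_muleNy ?lte_fin.
by rewrite big_ord_recl expr0 mul1e tr_head rrNy.
Qed.

(** The reference has a finite value, so no optimal policy can have value [-oo]
    from some state. *)
Lemma optimal_positive pi : is_optimal M pi_ref lambda pi -> positive_policy pi.
Proof.
move=> [hpi opt]; split=> // s a; rewrite lt0r (hpi s).1 andbT; apply/eqP => pisa.
have := opt pi_ref s ref_policy.
by rewrite (evalue_eqNy hpi pisa) evalueE//; exact: point_mass_dist.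
Qed.

(** The advantages average to zero: the Bellman equation of [pi]. *)
Lemma bellman pi s : positive_policy pi ->
  \sum_a pi s a * advantage M pi_ref lambda pi s a = 0.
Proof.
move=> hpi; have [hp pi0] := hpi; rewrite /advantage /qvalue value_point_massE//.
set V := resolvent M pi (mean_reward pi).
have -> : \sum_a pi s a * (reward M s a - lambda * D pi s + gamma * (\sum_s'
      trans M s a s' * value M pi_ref lambda pi (point_mass R s')) - V s)
    = mean_reward pi s + gamma * push M pi V s - V s.
  rewrite -[X in _ - X]mul1r -(hp s).2 mulr_suml -policy_meanE// /push mulr_sumr.
  rewrite -big_split -sumrB; apply: eq_bigr => a _ /=.
  under eq_bigr do rewrite value_point_massE//.
  by rewrite -/V; ring.
by rewrite push_resolvent// -resolvent_push// subrr.
Qed.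

(** The advantage of [pi'] over [pi] in one step, including the change of the
    regularizer. *)
Definition policy_gain pi pi' (s : S) : R :=
  \sum_a pi' s a * advantage M pi_ref lambda pi s a + lambda * (D pi s - D pi' s).

Lemma policy_gainE pi pi' s : positive_policy pi -> positive_policy pi' ->
  policy_gain pi pi' s
  = state_gain (pi s) (pi_ref s) (advantage M pi_ref lambda pi s) lambda (pi' s).
Proof.
move=> [_ pi0] [_ pi'0]; congr (_ + _ * _); rewrite !fine_klE// -sumrB.
apply: eq_bigr => a _; rewrite -mulrBr !ln_div ?posrE//.
by congr (_ * _); ring.
Qed.

(** Performance difference: the value of [pi'] exceeds that of [pi] by the
    gains accumulated along the chain of [pi']. *)
Lemma performance_difference pi pi' rho : positive_policy pi ->
  positive_policy pi' -> is_dist rho ->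
  value M pi_ref lambda pi' rho - value M pi_ref lambda pi rho
  = \sum_s rho s * resolvent M pi' (policy_gain pi pi') s.
Proof.
move=> hpi hpi' hrho; rewrite !valueE// -sumrB; apply: eq_bigr => s _.
rewrite -mulrBr; congr (_ * _); have [hp' _] := hpi'.
set V := resolvent M pi (mean_reward pi).
have -> : V s = resolvent M pi' (fun x => V x - gamma * push M pi' V x) s.
  by rewrite resolventB// resolventZ// [X in X - _]resolvent_push// addrK.
rewrite -resolventB//; congr (resolvent _ _ _ s); apply/funext => x.
rewrite /policy_gain /advantage /qvalue value_point_massE// -/V.
have -> : \sum_a pi' x a * (reward M x a - lambda * D pi x + gamma * (\sum_s'
      trans M x a s' * value M pi_ref lambda pi (point_mass R s')) - V x)
    = \sum_a pi' x a * reward M x a + gamma * push M pi' V x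
      - (lambda * D pi x + V x).
  rewrite -[X in _ = _ - X]mul1r -[X in _ - X * _](hp' x).2 mulr_suml /push mulr_sumr.
  rewrite -big_split -sumrB; apply: eq_bigr => a _ /=.
  under eq_bigr do rewrite value_point_massE//.
  by rewrite -/V; ring.
by rewrite /mean_reward; ring.
Qed.

Section Sublevel.
Variables (u : S -> R) (c_u : R) (pi1 : S -> A -> R).
Hypotheses (u_dist : is_dist u) (c_u_gt0 : 0 < c_u) (u_ge : forall s, c_u <= u s).

Local Notation CA := (C_A M pi_ref lambda u c_u pi1).
Local Notation rmax := (reward_max M).

Lemma mean_reward_le pi s : positive_policy pi ->
  mean_reward pi s <= rmax - lambda * D pi s.
Proof.
move=> [hp _]; rewrite lerD2r; apply: mean_le => // a.
by have /andP[] := reward_bounds M s a.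
Qed.

(** A policy at least as good as [pi1] has bounded divergence from the
    reference: the rewards cannot make up for a larger one. *)
Lemma divergence_le pi s : positive_policy pi ->
  value M pi_ref lambda pi1 u <= value M pi_ref lambda pi u -> D pi s <= CA.
Proof.
move=> hpi; have [hp pi0] := hpi; rewrite [X in _ <= X -> _]valueE// => hV.
have D0 x : 0 <= D pi x by exact: fine_kl_ge0.
have r_le x : resolvent M pi (mean_reward pi) x
    <= rmax / (1 - gamma) - lambda * D pi x.
  apply: (@le_trans _ _ (resolvent M pi (fun y => rmax - lambda * D pi y) x)).
    by apply: le_resolvent => // y; exact: mean_reward_le.
  rewrite resolventB// resolvent_cst// lerD2l lerN2 resolventZ//.
  by rewrite (ler_pM2l lambda_gt0); exact: resolvent_ge.
have : value M pi_ref lambda pi1 u <= rmax / (1 - gamma) - lambda * (u s * D pi s).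
  apply: (le_trans hV); have [u0 u1] := u_dist.
  apply: (@le_trans _ _ (\sum_x u x * (rmax / (1 - gamma) - lambda * D pi x))).
    by apply: ler_sum => x _; rewrite ler_wpM2l.
  under eq_bigr do rewrite mulrBr; rewrite sumrB -mulr_suml u1 mul1r lerD2l lerN2.
  rewrite (bigD1 s)//= mulrCA lerDl; apply: sumr_ge0 => x _.
  by rewrite mulr_ge0// mulr_ge0// ltW.
rewrite /C_A ler_pdivlMr ?mulr_gt0// => h.
have : lambda * (c_u * D pi s) <= lambda * (u s * D pi s).
  by rewrite (ler_pM2l lambda_gt0) ler_wpM2r.
nra.
Qed.

Lemma reward_max_ge0 (s : S) (a : A) : 0 <= rmax.
Proof. by have /andP[] := reward_bounds M s a; exact: le_trans. Qed.

Lemma value_norm_le pi s (a : A) : positive_policy pi ->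
  value M pi_ref lambda pi1 u <= value M pi_ref lambda pi u ->
  `|value M pi_ref lambda pi (point_mass R s)|
  <= (rmax + lambda * CA) / (1 - gamma).
Proof.
move=> hpi hV; have [hp pi0] := hpi; rewrite value_point_massE//.
have D0 x : 0 <= D pi x by exact: fine_kl_ge0.
have DC x := divergence_le x hpi hV.
have l0 := lambda_gt0; have r0 := reward_max_ge0 s a.
have lC : 0 <= lambda * CA by apply: mulr_ge0; [exact: ltW | exact: le_trans (DC s)].
have lD x : 0 <= lambda * D pi x <= lambda * CA.
  by rewrite mulr_ge0 ?(ltW l0)//= ler_wpM2l ?(ltW l0).
have bound x : - (rmax + lambda * CA) <= mean_reward pi x <= rmax + lambda * CA.
  have /andP[d0 d1] := lD x; have := mean_reward_le x hpi.
  have : 0 <= \sum_b pi x b * reward M x b.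
    by apply: mean_ge => // b; have /andP[] := reward_bounds M x b.
  by rewrite /mean_reward => *; apply/andP; split; lra.
rewrite ler_norml -mulNr -!(resolvent_cst M hp _ s).
by apply/andP; split; apply: le_resolvent => // x; have /andP[] := bound x.
Qed.

Lemma advantage_norm_le pi s a : positive_policy pi ->
  value M pi_ref lambda pi1 u <= value M pi_ref lambda pi u ->
  `|advantage M pi_ref lambda pi s a| <= 3 * ((rmax + lambda * CA) / (1 - gamma)).
Proof.
move=> hpi hV; have [hp pi0] := hpi.
have D0 : 0 <= D pi s by exact: fine_kl_ge0.
have DC := divergence_le s hpi hV; have l0 := lambda_gt0.
have r0 := reward_max_ge0 s a; have /andP[r1 r2] := reward_bounds M s a.
have g0 := subr1_gamma_gt0 M; have g1 := gamma_ge0 M.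
have lD : 0 <= lambda * D pi s by rewrite mulr_ge0// ltW.
have lDC : lambda * D pi s <= lambda * CA by rewrite ler_wpM2l// ltW.
set B := (rmax + lambda * CA) / (1 - gamma).
have B_ge : rmax + lambda * CA <= B.
  by rewrite ler_pdivlMr// ler_piMr//; lra.
have := value_norm_le s a hpi hV; rewrite -/B => hs.
have next : `|gamma * \sum_s' trans M s a s'
     * value M pi_ref lambda pi (point_mass R s')| <= B.
  rewrite normrM ger0_norm// -[leRHS]mul1r; apply: ler_pM => //.
    by have := gamma_lt1 M; lra.
  by apply: mean_norm_le => [|x]; [exact: trans_dist | exact: value_norm_le].
rewrite /advantage /qvalue; move: hs next; rewrite !ler_norml.
by move=> /andP[? ?] /andP[? ?]; apply/andP; split; lra.
Qed.

Lemma softmax_positive (theta : S -> A -> R) : (0 < #|A|)%N ->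
  positive_policy (softmax theta).
Proof.
move=> /card_gt0P[a _]; split=> [s|s b]; last exact: softmax_gt0.
split=> [b|]; first exact/ltW/softmax_gt0.
by rewrite -mulr_suml mulfV// gt_eqF// (softmax_sum_gt0 _ _ a).
Qed.

(** The set defining [A_F_max] is bounded, so that its supremum is a bound. *)
Lemma advantage_softmax_le (theta : S -> A -> R) s a :
  value M pi_ref lambda pi1 u <= value M pi_ref lambda (softmax theta) u ->
  `|advantage M pi_ref lambda (softmax theta) s a|
  <= A_F_max M pi_ref lambda u pi1.
Proof.
move=> hV; apply: ub_le_sup; last by exists theta, s, a.
exists (3 * ((rmax + lambda * CA) / (1 - gamma))) => _ [th [x [b [h ->]]]].
by apply: advantage_norm_le => //; apply: softmax_positive; apply/card_gt0P; exists b.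
Qed.

Lemma c_ref_le s a : c_ref pi_ref <= pi_ref s a.
Proof. exact: (bigmin_le 1 (s, a) (fun sa => pi_ref sa.1 sa.2)). Qed.

(** Each action has probability at least [c_F]: otherwise its term alone would
    make the cross entropy too large. *)
Lemma c_F_le pi s a : positive_policy pi -> 0 < c_ref pi_ref ->
  value M pi_ref lambda pi1 u <= value M pi_ref lambda pi u ->
  c_F M pi_ref lambda u c_u pi1 <= pi s a.
Proof.
move=> hpi c0 hV; have [hp pi0] := hpi.
have DC := divergence_le s hpi hV.
have := cross_entropy_le (ref_policy s) (ref_gt0 s) (pi0 s).
rewrite -sumrN (bigD1 a)//= => h.
have ln0 b : ln (pi s b) <= 0 by apply/ln_le0/dist_le1.
have rest : 0 <= \sum_(b | b != a) - (pi_ref s b * ln (pi s b)).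
  by apply: sumr_ge0 => b _; rewrite -mulrN mulr_ge0 ?oppr_ge0// ltW.
have : c_ref pi_ref * - ln (pi s a) <= pi_ref s a * - ln (pi s a).
  by rewrite ler_wpM2r ?oppr_ge0// c_ref_le.
move=> ca; rewrite -[leRHS]lnK ?posrE// ler_expR ler_pdivrMr//.
by rewrite mulrN in ca; lra.
Qed.

End Sublevel.

End Values.

(** * The outer iteration *)

Section SoftmaxGradient.
Variables (R : realType) (S A : finType).
Implicit Types theta : S -> A -> R.

Lemma partial_ln_softmax theta s a s' a' :
  partial (fun th => ln (softmax th s a)) theta s' a'
  = (s == s')%:R * ((a == a')%:R - softmax theta s a').
Proof.
rewrite /partial derive1E; apply: derive_val.
have -> : (fun x => ln (softmax (upd theta s' a' x) s a))
    = (fun x => upd theta s' a' x s a - ln (\sum_b expR (upd theta s' a' x s b))).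
  apply/funext => x; rewrite /softmax ln_div ?posrE ?expR_gt0 ?expRK//.
  exact: (softmax_sum_gt0 _ _ a).
have d b : is_derive (theta s' a') (1 : R) (fun x => upd theta s' a' x s b)
    (((s == s') && (b == a'))%:R).
  rewrite /upd; case: (_ && _); first exact: is_derive_id.
  exact: is_derive_cst.
have e b : is_derive (theta s' a') (1 : R) (fun x => expR (upd theta s' a' x s b))
    (((s == s') && (b == a'))%:R * expR (theta s b)).
  have := is_derive1_comp (is_derive_expR _) (d b).
  by rewrite upd_id mulrC.
have Z0 := softmax_sum_gt0 theta s a.
have Z0' : 0 < \sum_b expR (upd theta s' a' (theta s' a') s b) by rewrite upd_id.
have l := is_derive1_comp (is_derive1_ln Z0') (is_derive_bigsum e).
have := is_deriveB (d a) l; rewrite upd_id => dB.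
apply: (is_derive_eq dB).
case: eqP => [->|_] /=; last first.
  by rewrite [X in _ * X]big1 ?mulr0 ?subr0 ?mul0r// => b _; rewrite mul0r.
rewrite mul1r; congr (_ - _); rewrite [X in _ * X](bigD1 a')//= eqxx mul1r.
rewrite [X in _ + X]big1 ?addr0 => [|b /negPf ->]; last by rewrite mul0r.
by rewrite /softmax mulrC.
Qed.

Lemma softmax_tilt theta0 theta s :
  softmax theta s = tilt (softmax theta0 s) (fun a => theta s a - theta0 s a).
Proof.
apply/funext => a; rewrite /tilt /tilt_mass.
have Z0 := softmax_sum_gt0 theta0 s a; have Z := softmax_sum_gt0 theta s a.
have e b : softmax theta0 s b * expR (theta s b - theta0 s b)
    = expR (theta s b) / \sum_b expR (theta0 s b).
  rewrite /softmax mulrAC -expRD; congr (expR _ / _); ring.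
rewrite (eq_bigr _ (fun b _ => e b)) e.
by rewrite -mulr_suml /softmax; field; rewrite !gt_eqF.
Qed.

End SoftmaxGradient.

Section Outer.
Variables (R : realType) (S A : finType) (M : mdp R S A).
Variables (pi_ref : S -> A -> R) (lambda : R) (u : S -> R) (c_u : R).
Variables (eps_l eps_h : R).
Hypothesis ref_policy : is_policy pi_ref.
Hypothesis c_ref_gt0 : 0 < c_ref pi_ref.
Hypothesis lambda_gt0 : 0 < lambda.
Hypotheses (u_dist : is_dist u) (c_u_gt0 : 0 < c_u) (u_ge : forall s, c_u <= u s).
Hypotheses (eps_l_bounds : 0 < eps_l < 1) (eps_h_gt0 : 0 < eps_h).
Hypothesis A_gt0 : (0 < #|A|)%N.

Local Notation gamma := (discount M).
Local Notation adv pi s := (advantage M pi_ref lambda pi s).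
Local Notation V pi := (value M pi_ref lambda pi u).

Let ref_gt0 s a : 0 < pi_ref s a.
Proof. exact: lt_le_trans (c_ref_le _ _ _). Qed.

(** The squared norm of the gradient of the one-step gain at the policy [pi] with
    respect to the logits of the state [s]. *)
Definition sqr_state_grad (pi : S -> A -> R) (s : S) : R :=
  \sum_a state_grad (pi s) (pi_ref s) (adv pi s) lambda a ^+ 2.

(** The gradient splits over the states, with the visitation as weight. *)
Lemma ppo_grad_stateE theta0 theta s a :
  ppo_grad M pi_ref lambda u eps_l eps_h theta0 theta s a
  = visitation M (softmax theta0) u s / (1 - gamma)
    * clipped_grad (pi_ref s) (adv (softmax theta0) s) lambda (softmax theta s)
        (unclipped M pi_ref lambda eps_l eps_h theta0 theta s) a.
Proof.
rewrite /ppo_grad /old_expect (bigD1 s)//=.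
rewrite [X in _ * (_ + X)]big1 ?addr0 => [|x xs]; last first.
  rewrite big1 ?mulr0// => b _.
  by rewrite partial_ln_softmax (negPf xs) !mul0r mulr0.
rewrite mulrA [_^-1 * _]mulrC; congr (_ * _).
set I := unclipped _ _ _ _ _ _ _ _; set d := adv _ _; set p := softmax theta s.
have hp : is_dist p := (softmax_positive theta A_gt0).1 s.
have [q0 q1] := ref_policy s; have [p0 p1] := hp.
transitivity (\sum_b ((b == a)%:R - p a) * ((I b)%:R * p b * d b + lambda * pi_ref s b)).
  apply: eq_bigr => b _; rewrite partial_ln_softmax eqxx mul1r /Defs.ratio -/p -/I -/d.
  have := softmax_gt0 theta0 s b; set p0b := softmax theta0 s b => p0b_gt0.
  by field; rewrite gt_eqF.
under eq_bigr do rewrite mulrBl; rewrite sumrB.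
rewrite (bigD1 a)//= eqxx mul1r.
rewrite [X in _ + X - _]big1 => [|b /negPf ->]; last by rewrite mul0r.
rewrite -mulr_sumr big_split /= -mulr_sumr q1 /clipped_grad.
have -> : \sum_b p b * ((I b)%:R * d b) = \sum_b (I b)%:R * p b * d b.
  by apply: eq_bigr => b _; ring.
ring.
Qed.

Lemma kappa_ge : [/\ 0 < ln (1 + eps_h), ln (1 - eps_l) < 0 &
  (ln (1 + eps_h))^-1 <= kappa eps_l eps_h /\
  - (ln (1 - eps_l))^-1 <= kappa eps_l eps_h].
Proof.
have /andP[l0 l1] := eps_l_bounds.
have h : 0 < ln (1 + eps_h) by rewrite ln_gt0// ltrDl.
have l : ln (1 - eps_l) < 0 by rewrite ln_lt0// subr_gt0 l1 gtrBl.
split=> //; rewrite /kappa; split.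
  by rewrite lerDl oppr_ge0 invr_le0 ltW.
by rewrite lerDr invr_ge0 ltW.
Qed.

Lemma kappa_ge0 : 0 <= kappa eps_l eps_h.
Proof.
have [h _ [k _]] := kappa_ge; apply: le_trans k.
by rewrite invr_ge0 ltW.
Qed.

(** An action is only clipped once its probability has moved away from that of
    the old policy, so that the indicator of clipping is bounded by a multiple of
    the displacement. *)
Lemma clipped_ln_ratio theta0 theta s a :
  ~~ unclipped M pi_ref lambda eps_l eps_h theta0 theta s a ->
  1 <= kappa eps_l eps_h * `|ln (Defs.ratio theta0 theta s a)|.
Proof.
have [h l [kh kl]] := kappa_ge; have /andP[l0 l1] := eps_l_bounds.
have eh := eps_h_gt0; rewrite /unclipped; set r := Defs.ratio _ _ _ _.
have r0 : 0 < r by rewrite divr_gt0 ?softmax_gt0.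
rewrite negb_or !negb_and -!ltNge -leNgt => /andP[/orP[a0|rh] /orP[a1|rl]].
- by move: (lt_le_trans a0 a1); rewrite ltxx.
- have lr : ln r <= ln (1 - eps_l) by rewrite ler_ln ?posrE ?subr_gt0 ?(ltW rl).
  rewrite ltr0_norm; last exact: le_lt_trans l.
  apply: (@le_trans _ _ (- (ln (1 - eps_l))^-1 * - ln (1 - eps_l))).
    by rewrite mulrNN mulVf ?lt_eqF.
  apply: ler_pM => //; rewrite ?oppr_ge0 ?invr_le0 ?(ltW l)//.
  by rewrite lerN2.
- have lr : ln (1 + eps_h) <= ln r.
    by rewrite ler_ln ?posrE ?(ltW rh)//; lra.
  rewrite gtr0_norm; last exact: lt_le_trans lr.
  apply: (@le_trans _ _ ((ln (1 + eps_h))^-1 * ln (1 + eps_h))).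
    by rewrite mulVf ?gt_eqF.
  by apply: ler_pM; rewrite ?invr_ge0 ?(ltW h).
- by exfalso; lra.
Qed.

Section Reference.
Variables (pi1 : S -> A -> R).
Local Notation AF := (A_F_max M pi_ref lambda u pi1).
Local Notation Ce := (C_e M pi_ref lambda u pi1 eps_l eps_h).
Local Notation cF := (c_F M pi_ref lambda u c_u pi1).

Section Ascent.
Variables (K : nat) (eta : nat -> R) (theta : nat -> S -> A -> R) (s_max : R).
Hypothesis inner : forall k s a, (1 <= k <= K)%N -> theta k.+1 s a
  = theta k s a + eta k * ppo_grad M pi_ref lambda u eps_l eps_h
                            (theta 1%N) (theta k) s a.
Hypothesis eta_ge0 : forall k, (1 <= k <= K)%N -> 0 <= eta k.
Hypothesis eta_sum : \sum_(1 <= i < K.+1) eta i = s_max.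
Hypothesis s_max_le : s_max <= (1 - gamma) / (8 * Ce).
Hypothesis sublevel : V pi1 <= V (softmax (theta 1%N)).

Lemma policy_gain_outer_ge s :
  visitation M (softmax (theta 1%N)) u s / (1 - gamma) * s_max / 2
    * sqr_state_grad (softmax (theta 1%N)) s
  <= policy_gain M pi_ref lambda (softmax (theta 1%N)) (softmax (theta K.+1)) s.
Proof.
set pi0 := softmax (theta 1%N); set tau := visitation _ _ _ _ / _.
have pos th := @softmax_positive R S A th A_gt0.
have [hpi0 pi0_gt0] := pos (theta 1%N); rewrite -/pi0 in hpi0 pi0_gt0.
have hpi0_s := hpi0 s; have g0 := subr1_gamma_gt0 M.
have dv := visitation_dist M hpi0 u_dist.
have tau0 : 0 <= tau by rewrite divr_ge0 ?(ltW g0)//; case: dv.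
have adv_le a : `|adv pi0 s a| <= AF.
  exact: (advantage_softmax_le ref_policy ref_gt0 lambda_gt0 u_dist c_u_gt0 u_ge).
have [a0 _] := card_gt0P A_gt0.
have AF0 : 0 <= AF by apply: le_trans (adv_le a0).
have kap0 := kappa_ge0.
have Ce0 := lipschitz_const_gt0 lambda_gt0 kap0 AF0.
have mean0 := bellman M lambda ref_gt0 s (pos (theta 1%N)).
rewrite policy_gainE// (softmax_tilt (theta 1%N) (theta K.+1) s) -/pi0.
have wS : \sum_(k < K) tau * eta k.+1 = tau * s_max.
  by rewrite -mulr_sumr -eta_sum big_add1 /= big_mkord.
rewrite -wS.
apply: (inner_loop_ascent hpi0_s (pi0_gt0 s) (ref_policy s) lambda_gt0 kap0 AF0
  adv_le mean0 (d := fun k a => theta k.+1 s a - theta 1%N s a)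
  (I := fun k => unclipped M pi_ref lambda eps_l eps_h (theta 1%N) (theta k.+1) s)
  (w := fun k => tau * eta k.+1)) => //.
- by move=> a; rewrite subrr.
- move=> k a kK; rewrite inner// ppo_grad_stateE -/pi0 -/tau.
  by rewrite (softmax_tilt (theta 1%N) (theta k.+1) s) -/pi0; ring.
- by move=> k kK; rewrite mulr_ge0// eta_ge0.
- move=> k a kK /clipped_ln_ratio.
  by rewrite /Defs.ratio (softmax_tilt (theta 1%N) (theta k.+1) s).
- rewrite wS.
  apply: (@le_trans _ _ ((1 - gamma)^-1 * ((1 - gamma) / (8 * Ce)) * (8 * Ce))).
    rewrite ler_pM2r ?mulr_gt0//; apply: ler_pM => //.
      rewrite -eta_sum big_nat; apply: sumr_ge0 => k /andP[k1 kK].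
      by apply: eta_ge0; rewrite k1.
    by rewrite -[leRHS]mul1r ler_wpM2r ?invr_ge0 ?(ltW g0)// dist_le1.
  by rewrite -mulrA divfK ?mulVf// gt_eqF// mulr_gt0.
Qed.

(** The gains being nonnegative, their accumulation is at least the gain of the
    initial step. *)
Lemma value_outer_ge : 0 <= s_max ->
  s_max * c_u / 2 * (\sum_s u s * sqr_state_grad (softmax (theta 1%N)) s)
  <= V (softmax (theta K.+1)) - V (softmax (theta 1%N)).
Proof.
move=> s0; have pos th := @softmax_positive R S A th A_gt0.
have [hpi0 _] := pos (theta 1%N); have [hpi' _] := pos (theta K.+1).
rewrite (performance_difference M lambda ref_gt0 (pos _) (pos _) u_dist).
have g0 := subr1_gamma_gt0 M; have [u0 _] := u_dist.
set pi0 := softmax (theta 1%N).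
have H0 s : 0 <= sqr_state_grad pi0 s by exact: sumr_sqr_ge0.
rewrite mulr_sumr; apply: ler_sum => s _.
apply: (@le_trans _ _ (u s * policy_gain M pi_ref lambda pi0 (softmax (theta K.+1)) s)).
  rewrite mulrCA ler_wpM2l//; apply: le_trans (policy_gain_outer_ge s).
  rewrite ler_wpM2r// ler_pM2r ?invr_gt0// mulrC ler_wpM2r//.
  apply: (le_trans (u_ge s)); rewrite ler_pdivlMr// mulrC.
  exact: visitation_ge.
rewrite ler_wpM2l//; apply: resolvent_ge => // x.
apply: le_trans (policy_gain_outer_ge x); rewrite mulr_ge0// divr_ge0// mulr_ge0//.
by rewrite divr_ge0 ?(ltW g0)//; case: (visitation_dist M hpi0 u_dist).
Qed.

End Ascent.

(** Gradient domination for the value. *)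
Lemma value_gap_le pi pi' : positive_policy pi -> positive_policy pi' ->
  V pi1 <= V pi ->
  V pi' - V pi <= mismatch (visitation M pi' u) u
    / ((1 - gamma) * (2 * lambda * c_ref pi_ref * cF ^+ 2))
    * \sum_s u s * sqr_state_grad pi s.
Proof.
move=> hpi hpi' hV; have [hp pi0] := hpi; have [hp' pi'0] := hpi'.
have g0 := subr1_gamma_gt0 M; have [u0 _] := u_dist.
have cF0 : 0 < cF := expR_gt0 _.
set c := 2 * lambda * c_ref pi_ref * cF ^+ 2.
have c0 : 0 < c by rewrite !mulr_gt0 ?exprn_gt0.
rewrite (performance_difference M lambda ref_gt0 hpi hpi' u_dist).
apply: (@le_trans _ _
  (\sum_s u s * resolvent M pi' (fun x => sqr_state_grad pi x / c) s)).
  apply: ler_sum => s _; rewrite ler_wpM2l//; apply: le_resolvent => // x.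
  rewrite policy_gainE//; apply: state_gain_le => //.
  - exact: bellman.
  - by move=> a; exact: c_ref_le.
  - by move=> a; exact: (c_F_le ref_policy ref_gt0 lambda_gt0 u_dist).
rewrite -(ler_pM2l g0) -sum_visitation_mul//.
have -> : (1 - gamma) * (mismatch (visitation M pi' u) u / ((1 - gamma) * c)
     * \sum_s u s * sqr_state_grad pi s)
  = \sum_s mismatch (visitation M pi' u) u * u s * (sqr_state_grad pi s / c).
  rewrite !mulr_sumr; apply: eq_bigr => s _.
  by field; rewrite !gt_eqF.
apply: ler_sum => s _; rewrite ler_wpM2r//.
  by rewrite divr_ge0 ?(ltW c0)//; exact: sumr_sqr_ge0.
have us : 0 < u s by apply: lt_le_trans (u_ge s).
rewrite -ler_pdivrMr//; exact: (le_bigmax 0 (fun x => visitation M pi' u x / u x) s).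
Qed.

Lemma mismatch_gt0 pi (s : S) : is_policy pi -> 0 < mismatch (visitation M pi u) u.
Proof.
move=> hp; have us : 0 < u s by apply: lt_le_trans (u_ge s).
apply: (@lt_le_trans _ _ (visitation M pi u s / u s)).
  rewrite divr_gt0//; apply: lt_le_trans (visitation_ge _ hp s u_dist).
  by rewrite mulr_gt0// subr1_gamma_gt0.
exact: (le_bigmax 0 (fun x => visitation M pi u x / u x) s).
Qed.

End Reference.
End Outer.

(** * Linear convergence *)

Section Convergence.
Variables (R : realType) (S A : finType) (M : mdp R S A).
Variables (pi_ref : S -> A -> R) (lambda : R) (u : S -> R) (c_u : R).
Hypothesis ref_policy : is_policy pi_ref.
Hypothesis ref_gt0 : forall s a, 0 < pi_ref s a.
Hypothesis lambda_gt0 : 0 < lambda.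
Hypotheses (u_dist : is_dist u) (c_u_gt0 : 0 < c_u) (u_ge : forall s, c_u <= u s).

Lemma optimal_state_value_ge pi_star pi s :
  is_optimal M pi_ref lambda pi_star -> positive_policy pi ->
  resolvent M pi (mean_reward M pi_ref lambda pi) s
  <= resolvent M pi_star (mean_reward M pi_ref lambda pi_star) s.
Proof.
move=> opt hpi; have [hp _] := hpi.
have hstar := optimal_positive ref_policy ref_gt0 lambda_gt0 opt.
have := opt.2 pi s hp; rewrite !(evalueE M lambda ref_gt0)//.
- by rewrite lee_fin !sum_point_mass.
- exact: point_mass_dist.
- exact: point_mass_dist.
Qed.

Lemma optimality_gap_ge0 pi_star pi rho :
  is_optimal M pi_ref lambda pi_star -> positive_policy pi -> is_dist rho ->
  0 <= value M pi_ref lambda pi_star rho - value M pi_ref lambda pi rho.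
Proof.
move=> opt hpi hrho; have [rho0 _] := hrho.
have hstar := optimal_positive ref_policy ref_gt0 lambda_gt0 opt.
rewrite subr_ge0 !(valueE M lambda ref_gt0)//; apply: ler_sum => s _.
by rewrite ler_wpM2l// optimal_state_value_ge.
Qed.

(** The gap from any initial distribution is controlled by the gap from [u],
    because an optimal policy is better in every state. *)
Lemma optimality_gap_le pi_star pi rho :
  is_optimal M pi_ref lambda pi_star -> positive_policy pi -> is_dist rho ->
  value M pi_ref lambda pi_star rho - value M pi_ref lambda pi rho
  <= (value M pi_ref lambda pi_star u - value M pi_ref lambda pi u) / c_u.
Proof.
move=> opt hpi hrho.
have hstar := optimal_positive ref_policy ref_gt0 lambda_gt0 opt.
rewrite !(valueE M lambda ref_gt0)// -!sumrB mulr_suml; apply: ler_sum => s _.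
rewrite -!mulrBr [leRHS]mulrAC ler_wpM2r//.
  by rewrite subr_ge0 optimal_state_value_ge.
apply: (@le_trans _ _ 1); first exact: dist_le1.
by rewrite ler_pdivlMr// mul1r.
Qed.

End Convergence.

Theorem theorem4p4 (R : realType) (S A : finType) (M : mdp R S A)
    (pi_ref : S -> A -> R) (lambda : R) (u : S -> R) (c_u eps_l eps_h : R)
    (K : nat) (eta : nat -> nat -> R) (theta : nat -> nat -> S -> A -> R)
    (S_max : R) (pi_star : S -> A -> R)
    (pi_ref_policy : is_policy pi_ref)
    (c_ref_gt0 : 0 < c_ref pi_ref)
    (lambda_gt0 : 0 < lambda)
    (u_dist : is_dist u)
    (c_u_gt0 : 0 < c_u)
    (u_ge : forall s, c_u <= u s)
    (eps_l_bounds : 0 < eps_l < 1)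
    (eps_h_gt0 : 0 < eps_h)
    (pi_star_optimal : is_optimal M pi_ref lambda pi_star)
    (run : is_ppo_run M pi_ref lambda u eps_l eps_h K eta theta)
    (start : forall s a, softmax (theta 1%N 1%N) s a = pi_ref s a)
    (eta_ge0 : forall n k, (1 <= n)%N -> (1 <= k <= K)%N -> 0 <= eta n k)
    (eta_sum : forall n, (1 <= n)%N -> \sum_(1 <= i < K.+1) eta n i = S_max)
    (S_max_gt0 : 0 < S_max)
    (S_max_le : S_max <= step_bound M pi_ref lambda u c_u
                           (softmax (theta 1%N 1%N)) eps_l eps_h) :
  forall (rho : S -> R) (n : nat), is_dist rho -> (1 <= n)%N ->
    value M pi_ref lambda pi_star rho
    - value M pi_ref lambda (softmax (theta n 1%N)) rho
    <= (value M pi_ref lambda pi_star u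
        - value M pi_ref lambda (softmax (theta 1%N 1%N)) u)
       / (c_u * (1 - discount M))
       * expR (- rate M pi_ref lambda u c_u (softmax (theta 1%N 1%N))
                   pi_star S_max * (n%:R - 1)).
Proof.
move=> rho n rho_dist n1.
have gap_step (x y z k X : R) : X <= y - z -> k * (x - z) <= X ->
    x - y <= (1 - k) * (x - z) by lra.
have exists_support (T : finType) (p : T -> R) : is_dist p -> exists x : T, True.
  move=> [_ p1]; case: (pickP (@predT T)) => [x _|T0]; first by exists x.
  by move/eqP: p1; rewrite big_pred0// eq_sym oner_eq0.
have [s0 _] := exists_support _ _ rho_dist.
have [a0 _] := exists_support _ _ (pi_ref_policy s0).
have A0 : (0 < #|A|)%N by apply/card_gt0P; exists a0.
have pos th := @softmax_positive R S A th A0.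
have ref_gt0 s a : 0 < pi_ref s a := lt_le_trans c_ref_gt0 (c_ref_le _ _ _).
have star_pos := optimal_positive pi_ref_policy ref_gt0 lambda_gt0 pi_star_optimal.
set pi1 := softmax (theta 1%N 1%N); set V := value M pi_ref lambda.
set c := rate _ _ _ _ _ _ _ _.
have g0 := subr1_gamma_gt0 M.
have g1 : (1 - discount M)^-1 >= 1.
  by rewrite invf_ge1//; have := gamma_ge0 M; lra.
have step_le : S_max <= (1 - discount M) / (8 * C_e M pi_ref lambda u pi1 eps_l eps_h).
  by apply: (le_trans S_max_le); rewrite /step_bound ge_min lexx.
have next m : (1 <= m)%N -> softmax (theta m.+1 1%N) = softmax (theta m K.+1).
  move=> m1; congr softmax; apply/funext => s; apply/funext => a.
  exact: run.2.
have ascent m : (1 <= m)%N -> V pi1 u <= V (softmax (theta m 1%N)) u ->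
    S_max * c_u / 2
      * (\sum_s u s * sqr_state_grad M pi_ref lambda (softmax (theta m 1%N)) s)
    <= V (softmax (theta m.+1 1%N)) u - V (softmax (theta m 1%N)) u.
  move=> m1 hV; rewrite next//.
  apply: (value_outer_ge pi_ref_policy c_ref_gt0 lambda_gt0 u_dist c_u_gt0 u_ge
    eps_l_bounds eps_h_gt0 A0 (pi1 := pi1) (eta := eta m) _ _ _ step_le hV
    (ltW S_max_gt0)).
  - by move=> k s a k1; exact: run.1.
  - by move=> k k1; exact: eta_ge0.
  - exact: eta_sum.
pose gap m := V pi_star u - V (softmax (theta m 1%N)) u.
have gap_ge0 m : 0 <= gap m.
  exact: (optimality_gap_ge0 pi_ref_policy ref_gt0 lambda_gt0).
have mm0 := mismatch_gt0 M u_dist c_u_gt0 u_ge s0 star_pos.1.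
have cF0 : 0 < c_F M pi_ref lambda u c_u pi1 := expR_gt0 _.
have contraction m : (1 <= m)%N -> V pi1 u <= V (softmax (theta m 1%N)) u ->
    gap m.+1 <= (1 - c) * gap m.
  move=> m1 hV; have asc := ascent m m1 hV.
  have dom := value_gap_le pi_ref_policy c_ref_gt0 lambda_gt0 u_dist c_u_gt0 u_ge
    (pos (theta m 1%N)) star_pos hV.
  have c0 : 0 <= c by rewrite /c /rate !mulr_ge0 ?invr_ge0 ?exprn_ge0 ?ltW.
  have := ler_wpM2l c0 dom; rewrite -/V -/(gap m).
  set E := \sum_s _ in asc *; set mm := mismatch _ _ in mm0 *.
  (* The rate is the quotient of the constants of ascent and of domination. *)
  have -> : c * (mm / ((1 - discount M) * (2 * lambda * c_ref pi_ref
      * c_F M pi_ref lambda u c_u pi1 ^+ 2)) * E) = S_max * c_u / 2 * E.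
    by rewrite /c /rate -/pi1 -/mm; field; rewrite !gt_eqF.
  move: asc; rewrite /gap; exact: gap_step.
have main m : V pi1 u <= V (softmax (theta m.+1 1%N)) u /\
    gap m.+1 <= gap 1%N * expR (- c * m%:R).
  elim: m => [|m [hV IH]]; first by rewrite mulr0 expR0 mulr1.
  split.
    apply: (le_trans hV); rewrite -subr_ge0; apply: le_trans (ascent m.+1 isT hV).
    apply: mulr_ge0; first by rewrite divr_ge0// mulr_ge0// ltW.
    by apply: sumr_ge0 => s _; rewrite mulr_ge0 ?sumr_sqr_ge0//; case: u_dist.
  apply: (le_trans (contraction m.+1 isT hV)).
  apply: (@le_trans _ _ (expR (- c) * gap m.+1)).
    by rewrite ler_wpM2r//; exact: expR_ge1Dx.
  rewrite -natr1 [- c * _]mulrDr mulr1 expRD mulrA [leRHS]mulrC.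
  by rewrite ler_wpM2l ?expR_ge0.
case: n n1 => // m _; have [_ gap_le] := main m.
apply: (le_trans (optimality_gap_le pi_ref_policy ref_gt0 lambda_gt0 u_dist c_u_gt0
  u_ge pi_star_optimal (pos _) rho_dist)).
have -> : m.+1%:R - 1 = m%:R :> R by rewrite -natr1 addrK.
have cu0 : 0 <= c_u^-1 by rewrite invr_ge0 ltW.
apply: (le_trans (ler_wpM2r cu0 gap_le)).
rewrite invfM mulrAC mulrA ler_wpM2r ?expR_ge0// ler_peMr//.
by rewrite mulr_ge0.
Qed.
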